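(* Let $(X,\delta,\mu)\in\mathcal{N}(\widetilde\tau,c_1,c_2)$ and assume that continuous functions are dense in $L^1(X,\mu)$. Let $s>0$ and let $\mathcal{K}=\{K_\alpha:0<\alpha<1\}$ be a family of symmetric Markov kernels on $X$ such that \begin{enumerate} \item[(a)] $\mathcal{K}\subset\mathcal{H}_a(\gamma,H)$ for some $H\geq1$ and some $\gamma$ with $0<\gamma\leq(\tfrac{c_1}{2c_2})^2$; \item[(b)] there exists $R>0$ such that $K_\alpha\in\mathcal{S}(s,\alpha,R)$ for every $0<\alpha<1$. \end{enumerate} Then \begin{enumerate} \item[(i)] $\mathcal{K}$ concentrates: for every $\lambda>0$, $\int_{\delta(x,y)\geq\lambda}K_\alpha(x,y)\,d\mu(y)\to0$ as $\alpha\to0$, uniformly in $x\in X$; \item[(ii)] the maximal operator $\mathcal{K}^*f(x)=\sup_{0<\alpha<1}\left|\int_XK_\alpha(x,y)f(y)\,d\mu(y)\right|$ is of weak type $(1,1)$ and bounded on $L^p(X,\mu)$ for $1<p\leq\infty$; \item[(iii)] for every $f\in L^p(X,\mu)$, $1\leq p\leq\infty$, $\int_XK_\alpha(x,y)f(y)\,d\mu(y)\to f(x)$ as $\alpha\to0^+$ for $\mu$-almost every $x\in X$. \end{enumerate}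
   Context: $(X,\delta,\mu)\in\mathcal{N}(\widetilde\tau,c_1,c_2)$ means: $\delta$ is a quasi-distance on $X$ (nonnegative, symmetric, vanishing exactly on the diagonal, with $\delta(x,z)\leq\widetilde\tau[\delta(x,y)+\delta(y,z)]$), $\delta$-balls $B_\delta(x,r)=\{y:\delta(x,y)<r\}$ are open and measurable, $\mu$ is a positive measure with $\mu(\{x\})=0$ for all $x$, $\mu(X)=+\infty$, and $0<c_1<c_2<\infty$ satisfy $c_1r\leq\mu(B_\delta(x,r))\leq c_2r$ for all $x\in X$, $r>0$. A symmetric Markov kernel on $X$ is a nonnegative symmetric measurable $K$ on $X\times X$ with $\int_XK(x,y)\,d\mu(y)=1$ for every $x$. For $0<\gamma<1$, $H\geq1$, $K\in\mathcal{H}_a(\gamma,H)$ means $\sup_{y\in A(x,\gamma r,r)}K(x,y)\leq H\inf_{y\in A(x,\gamma r,r)}K(x,y)$ for every $x\in X$ and $r>0$, where $A(x,\gamma r,r)=B_\delta(x,r)\setminus B_\delta(x,\gamma r)$. For $s,\alpha,R>0$, $K\in\mathcal{S}(s,\alpha,R)$ means $K(x,y)\leq\alpha\,\delta(x,y)^{-(1+s)}$ for all $x,y\in X$ with $\delta(x,y)>R$. Weak type $(1,1)$: $\mu(\{x:|Tf(x)|>\lambda\})\leq C\lambda^{-1}\|f\|_{L^1(\mu)}$ for all $f$ and $\lambda>0$. *)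

(* Defs.v *)
From HB Require Import structures.
From mathcomp Require Import all_boot all_order all_algebra.
From mathcomp Require Import all_classical all_reals all_analysis.
Set Implicit Arguments. Unset Strict Implicit. Unset Printing Implicit Defensive.
Import Order.TTheory GRing.Theory Num.Theory.
Import numFieldNormedType.Exports.
Local Open Scope classical_set_scope.
Local Open Scope ring_scope.

Section Defs.
Context {d : measure_display} {T : measurableType d} {R : realType}.

Definition dball (delta : T -> T -> R) (x : T) (r : R) : set T :=
  [set y | delta x y < r].

Definition dannulus (delta : T -> T -> R) (x : T) (a b : R) : set T :=
  dball delta x b `\` dball delta x a.

Definition quasi_distance (delta : T -> T -> R) (tau : R) : Prop :=
  [/\ forall x y, 0 <= delta x y,
      forall x y, delta x y = delta y x,
      forall x y, delta x y = 0 <-> x = y &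
      forall x y z, delta x z <= tau * (delta x y + delta y z)].

Definition delta_open (delta : T -> T -> R) (U : set T) : Prop :=
  forall x, U x -> exists2 r : R, 0 < r & dball delta x r `<=` U.

(* continuity w.r.t. the topology induced by delta (balls are open and form
   a neighbourhood base, so this is ordinary topological continuity) *)
Definition delta_continuous (delta : T -> T -> R) (g : T -> R) : Prop :=
  forall x (e : R), 0 < e ->
    exists2 r : R, 0 < r & forall y, delta x y < r -> `|g y - g x| < e.

Definition space_N (delta : T -> T -> R) (mu : {measure set T -> \bar R})
    (tau c1 c2 : R) : Prop :=
  [/\ quasi_distance delta tau,
      forall x r, delta_open delta (dball delta x r) &
      forall x r, measurable (dball delta x r)] /\
  [/\ forall x, mu [set x] = 0%E,
      mu setT = +oo%E,
      0 < c1 /\ c1 < c2 &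
      forall x r, 0 < r ->
        ((c1 * r)%:E <= mu (dball delta x r))%E /\
        (mu (dball delta x r) <= (c2 * r)%:E)%E].

Definition sym_markov_kernel (mu : {measure set T -> \bar R})
    (K : T -> T -> R) : Prop :=
  [/\ forall x y, 0 <= K x y,
      forall x y, K x y = K y x,
      measurable_fun [set: T * T] (fun p : T * T => K p.1 p.2) &
      forall x, (\int[mu]_y (K x y)%:E = 1)%E].

(* K in H_a(gamma, H): sup over annulus <= H * inf over annulus *)
Definition in_Ha (delta : T -> T -> R) (gamma H : R) (K : T -> T -> R) : Prop :=
  forall x (r : R), 0 < r ->
    forall y y', dannulus delta x (gamma * r) r y ->
                 dannulus delta x (gamma * r) r y' ->
      K x y <= H * K x y'.

Definition in_S (delta : T -> T -> R) (s alpha R0 : R) (K : T -> T -> R) : Prop :=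
  forall x y, R0 < delta x y -> K x y <= alpha * (delta x y) `^ (- (1 + s)).

Definition kernel_op (mu : {measure set T -> \bar R}) (K : T -> T -> R)
    (f : T -> R) (x : T) : \bar R :=
  (\int[mu]_y (K x y * f y)%:E)%E.

Definition max_op (mu : {measure set T -> \bar R}) (K : R -> T -> T -> R)
    (f : T -> R) (x : T) : \bar R :=
  ereal_sup [set `|kernel_op mu (K a) f x|%E | a in `]0, 1[%classic].

End Defs.

(* Main.v *)
(** The Harnack condition makes each kernel K(x, .) comparable with its mean on
    the annuli A(x, gamma r, r), whose measure is at least c1 r / 2. Hence a bound
    e r on the integrals of g over the balls B(x, r) yields a bound (2 H / c1) e on
    the integral of K(x, .) g, so the maximal operator of the family is dominated
    by a Hardy-Littlewood maximal function. The latter is taken over a countable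
    family of balls, which makes it measurable; a Vitali selection gives the weak
    (1,1) estimate, and dyadic summation of the weak estimate for truncations
    gives the L^p bounds.

    For the concentration, gamma <= (c1 / (2 c2))^2 makes consecutive annuli
    overlap, so that the decay of order alpha, assumed beyond distance R0,
    propagates down to any given scale lam at the cost of a power of H.

    Density of continuous functions and the weak estimate show that almost every
    point is a Lebesgue point of f. At such a point the annuli estimate controls
    the part of K(x, .) |f - f(x)| near x, and the concentration the far part,
    because |f| is dominated by a constant plus an integrable function. *)
Require Import Defs.
From HB Require Import structures.
From mathcomp Require Import all_boot all_order all_algebra.
From mathcomp Require Import all_classical all_reals all_analysis.
From mathcomp Require Import measurable_realfun ess_sup_inf.
From mathcomp Require Import ring lra.
Import Order.TTheory GRing.Theory Num.Theory.
Import numFieldNormedType.Exports.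
Local Open Scope classical_set_scope.
Local Open Scope ring_scope.

(** * Quasi-metric spaces whose balls have measure comparable with their radius *)

Section quasi_metric_space.
Context {R : realType} {d : measure_display} {T : measurableType d}.
Context {delta : T -> T -> R} {mu : {measure set T -> \bar R}}.
Context {tau c1 c2 : R}.
Hypothesis XN : space_N delta mu tau c1 c2.
Local Notation ball := (dball delta).

Lemma delta_ge0 x y : 0 <= delta x y.
Proof. by case: XN => -[[]]. Qed.

Lemma deltaC x y : delta x y = delta y x.
Proof. by case: XN => -[[]]. Qed.

Lemma deltaxx x : delta x x = 0.
Proof. by case: XN => -[[_ _ h _] _ _] _; apply/h. Qed.

Lemma delta_eq0 x y : delta x y = 0 -> x = y.
Proof. by case: XN => -[[_ _ h _] _ _] _ /h. Qed.

Lemma delta_triangle x y z : delta x z <= tau * (delta x y + delta y z).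
Proof. by case: XN => -[[]]. Qed.

Lemma measurable_dball x r : measurable (ball x r).
Proof. by case: XN => -[]. Qed.
Hint Resolve measurable_dball : core.

Lemma measure_point x : mu [set x] = 0%E.
Proof. by case: XN => _ []. Qed.

Lemma measure_space : mu setT = +oo%E.
Proof. by case: XN => _ []. Qed.

Lemma c1_gt0 : 0 < c1.
Proof. by case: XN => _ [_ _ []]. Qed.

Lemma c1_lt_c2 : c1 < c2.
Proof. by case: XN => _ [_ _ []]. Qed.

Lemma c2_gt0 : 0 < c2.
Proof. exact: lt_trans c1_gt0 c1_lt_c2. Qed.

Lemma measure_dball_ge x r : 0 < r -> ((c1 * r)%:E <= mu (ball x r))%E.
Proof. by move=> r0; case: XN => _ [_ _ _ /(_ x r r0)[]]. Qed.

Lemma measure_dball_le x r : 0 < r -> (mu (ball x r) <= (c2 * r)%:E)%E.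
Proof. by move=> r0; case: XN => _ [_ _ _ /(_ x r r0)[]]. Qed.

Lemma dball_center x r : 0 < r -> ball x r x.
Proof. by rewrite /dball/= deltaxx. Qed.

Lemma measurable_set1_space x : measurable ([set x] : set T).
Proof.
rewrite (_ : [set x] = \bigcap_n ball x n.+1%:R^-1); first exact: bigcapT_measurable.
apply/seteqP; split=> [y -> n _|y xy]; first exact: dball_center.
apply/esym/delta_eq0/eqP; rewrite eq_le delta_ge0 andbT leNgt; apply/negP => xy0.
have [n _ /(_ n (leqnn n)) /= hn] := near_infty_natSinv_lt (PosNum xy0).
by have := xy n I; rewrite /dball/= ltNge (ltW hn).
Qed.

Lemma exists_point : exists x : T, True.
Proof.
apply: contrapT => h; have := measure_space.
rewrite (_ : setT = set0) ?measure0// -subset0 => x _.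
by apply: h; exists x.
Qed.

(** Two distinct points exist, because a single point is null while the space has infinite measure;
    the quasi-triangle inequality for [x], [x], [y] then gives the bound. *)
Lemma tau_ge1 : 1 <= tau.
Proof.
have [x _] := exists_point.
have [y xy] : exists y, 0 < delta x y.
  apply: contrapT => h; have := measure_space.
  rewrite (_ : setT = [set x]) ?measure_point//.
  apply/seteqP; split => // y _ /=; apply/esym/delta_eq0/eqP.
  rewrite eq_le delta_ge0 andbT leNgt; apply/negP => xy; apply: h.
  by exists y.
have := delta_triangle x x y; rewrite deltaxx add0r.
by rewrite -[X in X <= _]mul1r ler_pM2r.
Qed.

Lemma tau_gt0 : 0 < tau.
Proof. exact: lt_le_trans ltr01 tau_ge1. Qed.

Lemma subset_dball x y r r' : tau * (delta x y + r) <= r' ->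
  ball y r `<=` ball x r'.
Proof.
move=> h z; rewrite /dball/= => yz.
rewrite (le_lt_trans (delta_triangle x y z))// (lt_le_trans _ h)//.
by rewrite ltr_pM2l ?tau_gt0// ltrD2l.
Qed.

Lemma dball_mono x r r' : r <= r' -> ball x r `<=` ball x r'.
Proof. by move=> rr' y; rewrite /dball/= => /lt_le_trans; apply. Qed.

Lemma bigcup_dball x : \bigcup_n ball x n%:R = setT.
Proof.
apply/seteqP; split => // y _; exists (Num.truncn (delta x y)).+1 => //.
by rewrite /dball/=; exact: truncnS_gt.
Qed.


(** A point common to two of the balls would put their centres at distance less than [tau * (e / (2
    * tau) + e / (2 * tau)) = e], so the balls are disjoint and their measures add. *)
Lemma measure_separated_balls (e : R) (s : seq T) : 0 < e ->
  pairwise (fun x y => e <= delta x y) s ->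
  ((c1 * (e / (2 * tau)) *+ size s)%:E
    <= mu (\bigcup_(x in [set` s]) ball x (e / (2 * tau))))%E.
Proof.
move=> e0; have e'0 : 0 < e / (2 * tau) by rewrite divr_gt0// mulr_gt0// tau_gt0.
elim: s => [_|x s ih /= /andP[xs ps]]; first by rewrite measure_ge0.
rewrite bigcup_seq big_cons -bigcup_seq measureU//.
- by rewrite mulrS EFinD leeD// ?measure_dball_ge// ih.
- exact: fin_bigcup_measurable.
- apply/seteqP; split=> // z [xz [y ys yz]].
  have := allP xs _ ys; rewrite leNgt => /negP; apply.
  rewrite (le_lt_trans (delta_triangle x z y))//.
  move: xz yz; rewrite /dball/= (deltaC y) => xz yz.
  rewrite -ltr_pdivlMl ?tau_gt0//.
  have -> : tau^-1 * e = e / (2 * tau) + e / (2 * tau).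
    by field; rewrite gt_eqF// tau_gt0.
  exact: ltrD.
Qed.

(** The disjoint balls of radius [e'] around the points all lie in one ball of radius
    [tau * (rho + e')]; comparing measures bounds their number. *)
Lemma separated_size_bounded x0 (rho e : R) : 0 < rho -> 0 < e ->
  exists m : nat, forall s : seq T, (forall x, x \in s -> ball x0 rho x) ->
  pairwise (fun x y => e <= delta x y) s -> (size s <= m)%N.
Proof.
move=> rho0 e0; have e'0 : 0 < e / (2 * tau) by rewrite divr_gt0// mulr_gt0// tau_gt0.
set e' := e / (2 * tau) in e'0.
have R0 : 0 < tau * (rho + e') by rewrite mulr_gt0 ?tau_gt0// addr_gt0.
exists (Num.truncn ((c2 * (tau * (rho + e'))) / (c1 * e'))) => s sB ps.
rewrite truncn_ge_nat//; last first.
  by rewrite divr_ge0// ltW// mulr_gt0// ?c2_gt0 ?c1_gt0.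
rewrite ler_pdivlMr; last by apply: mulr_gt0 => //; exact: c1_gt0.
rewrite mulr_natl -lee_fin.
rewrite (le_trans (measure_separated_balls _ _ e0 ps))//.
rewrite (le_trans _ (measure_dball_le x0 _ R0))// le_measure ?inE//.
  exact: fin_bigcup_measurable.
move=> y [x /sB xB]; apply: subset_dball.
by rewrite ler_pM2l ?tau_gt0// lerD2r ltW.
Qed.

(** A separated family of maximal size is a net, since a point of the ball at distance at least [e]
    from all its members could be added. *)
Lemma finite_net x0 (rho e : R) : 0 < rho -> 0 < e -> exists s : seq T,
  forall y, ball x0 rho y -> exists2 z, z \in s & delta z y < e.
Proof.
move=> rho0 e0; have [m hm] := separated_size_bounded x0 _ _ rho0 e0.
pose P n := `[< exists s : seq T, [/\ size s = n,
  forall x, x \in s -> ball x0 rho x & pairwise (fun x y => e <= delta x y) s] >].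
have P0 : exists n, P n by exists 0%N; apply/asboolP; exists [::].
have Pm n : P n -> (n <= m)%N.
  by move=> /asboolP[s [<- sB ps]]; exact: hm.
case: (ex_maxnP P0 Pm) => n /asboolP[s [sn sB ps]] maxn.
exists s => y yB; apply: contrapT => h.
have : P n.+1.
  apply/asboolP; exists (y :: s); split; first by rewrite /= sn.
    by move=> x; rewrite inE => /predU1P[->//|/sB].
  rewrite /= ps andbT; apply/allP => z zs; rewrite leNgt deltaC.
  by apply/negP => zy; apply: h; exists z.
by move=> /maxn; rewrite ltnn.
Qed.

(** The centres run through finite nets of the balls of radius [n.+1] around [x0], at every positive
    rational scale. *)
Lemma countable_ball_family : exists (z : nat -> T) (r : nat -> R),
  (forall n, 0 < r n) /\
  forall x rho, 0 < rho ->
    exists2 n, ball x rho `<=` ball (z n) (r n) & r n <= 4 * tau * rho.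
Proof.
have [x0 _] := exists_point.
have /choice[net netP] : forall nq : nat * rat, exists s : seq T,
    0 < ratr nq.2 :> R ->
    forall y, ball x0 nq.1.+1%:R y -> exists2 z, z \in s & delta z y < ratr nq.2.
  move=> [n q]/=; have [q0|q0] := ltP 0 (ratr q : R); last by exists [::].
  by have [//|s sP] := finite_net x0 n.+1%:R (ratr q) _ q0; exists s.
pose I := (nat * rat * nat)%type.
pose zI (i : I) := nth x0 (net i.1) i.2.
(* Radius 1 is a placeholder for scales that are not positive, among them the default scale 0 of
   indices that encode nothing; it keeps all radii positive. *)
pose rI (i : I) : R := if 0 < ratr i.1.2 :> R then 2 * tau * ratr i.1.2 else 1.
pose dI n : I := odflt (0%N, 0, 0%N) (unpickle n).
exists (zI \o dI), (rI \o dI); split => [n|x rho rho0] /=.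
  by rewrite /rI; case: ifPn => // q0; have := tau_gt0; nra.
(* A scale above [rho] gives the inclusion, the radius being [tau * (ratr q + ratr q)]; a scale
   below [2 * rho] gives the factor [4 * tau]. *)
have [q] : exists q : rat, rho < ratr q < 2 * rho.
  have : rho < 2 * rho by rewrite mulrDl mul1r ltrDl.
  by move=> /rat_in_itvoo[q]; rewrite in_itv/= => qE; exists q.
move=> /andP[rq qr]; have q0 : 0 < ratr q :> R by exact: lt_trans rq.
have [z zs zx] := netP (Num.truncn (delta x0 x), q) q0 x (truncnS_gt _).
exists (pickle (((Num.truncn (delta x0 x), q), index z (net (Num.truncn (delta x0 x), q))) : I)).
  rewrite /dI pickleK/= /zI/= nth_index// /rI/= q0; apply: subset_dball.
  rewrite (mulrC 2) -mulrA ler_pM2l ?tau_gt0// mulrDl mul1r lerD// ltW//.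
rewrite /dI pickleK/= /rI/= q0 (_ : 4 = 2 * 2); last by rewrite -natrM.
have := tau_gt0; nra.
Qed.

End quasi_metric_space.

(** * The Hardy-Littlewood maximal function of a countable family of balls *)

(** The means are uncentred and normalised by the radius, which is comparable with the measure of
    the ball. *)
Definition ball_maximal {R : realType} {d : measure_display} {T : measurableType d}
    (delta : T -> T -> R) (mu : {measure set T -> \bar R})
    (z : nat -> T) (r : nat -> R) (g : T -> \bar R) (x : T) : \bar R :=
  ereal_sup [set ((r n)^-1%:E * \int[mu]_(y in dball delta (z n) (r n)) g y)%E
            | n in [set n | dball delta (z n) (r n) x]].

Section ball_maximal_theory.
Context {R : realType} {d : measure_display} {T : measurableType d}.
Context {delta : T -> T -> R} {mu : {measure set T -> \bar R}}.
Context {tau c1 c2 : R}.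
Hypothesis XN : space_N delta mu tau c1 c2.
Context {z : nat -> T} {r : nat -> R}.
Hypothesis r_gt0 : forall n, 0 < r n.
Local Notation ball := (dball delta).
Local Notation B n := (dball delta (z n) (r n)).
Local Notation M := (ball_maximal delta mu z r).
Let mball := measurable_dball XN.
Hint Resolve mball : core.

(** Through a common point [w]: [delta x w < rx] and [delta w v <= 2 * tau * rx], and a second
    quasi-triangle inequality gives the factor. *)
Lemma dball_engulf x y rx ry : ry <= rx -> ball x rx `&` ball y ry !=set0 ->
  ball y ry `<=` ball x (tau * (1 + 2 * tau) * rx).
Proof.
move=> ryx [w [xw yw]] v; move: xw yw; rewrite /dball/= (deltaC XN y) => xw wy yv.
have h1 := delta_triangle XN x w v; have h2 := delta_triangle XN w y v.
have t0 := tau_gt0 XN; rewrite (le_lt_trans h1)// -mulrA ltr_pM2l//.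
rewrite mulrDl mul1r ltr_leD// (le_trans h2)//.
by rewrite (mulrC 2) -mulrA ler_pM2l//; lra.
Qed.

(* Keep a ball of largest radius and discard those meeting it: its dilation
   covers the discarded ones, and what remains is disjoint from it. *)
Lemma vitali_finite (g : T -> \bar R) (lam : R) (s : seq nat) :
  0 < lam -> measurable_fun [set: T] g -> (forall x, 0 <= g x)%E ->
  (forall n, n \in s -> ((lam * r n)%:E <= \int[mu]_(y in B n) g y)%E) ->
  (mu (\bigcup_(n in [set` s]) B n) <=
   (c2 * (tau * (1 + 2 * tau)) / lam)%:E * \int[mu]_(y in \bigcup_(n in [set` s]) B n) g y)%E.
Proof.
move=> lam0 mg g0; have t0 := tau_gt0 XN; have c0 := c2_gt0 XN.
have : 0 < tau * (1 + 2 * tau) by rewrite mulr_gt0// addr_gt0// mulr_gt0.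
have [k kE] : {k | k = tau * (1 + 2 * tau)} by exists (tau * (1 + 2 * tau)).
rewrite -kE => k0.
have mgD D : measurable_fun D g by exact: measurable_funTS.
have mU (s' : seq nat) : measurable (\bigcup_(n in [set` s']) B n).
  exact: fin_bigcup_measurable.
have [n sn] := ubnP (size s); elim: n s sn => // n ih s sn sP.
have [->|/eqP s_neq0] := eqVneq s [::].
  by rewrite set_nil bigcup_set0 measure0 integral_set0 mule0.
have [i is_ imax] : exists2 i, i \in s & forall j, j \in s -> r j <= r i.
  case: s s_neq0 {sn sP} => // a s _; elim: s a => [a|b s ihs a].
    by exists a; rewrite ?inE// => j; rewrite inE => /eqP ->.
  have [i is_ imax] := ihs b; have [ia|ai] := leP (r i) (r a).
    exists a; first by rewrite inE eqxx.
    move=> j; rewrite inE => /predU1P[->//|/imax /le_trans]; exact.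
  exists i; first by rewrite inE is_ orbT.
  move=> j; rewrite inE => /predU1P[->|/imax//]; exact: ltW.
pose s' := [seq j <- s | `[< B i `&` B j = set0 >]].
(* The nonempty ball [B i] meets itself, so at least [i] is discarded and the list gets shorter. *)
have s's : (size s' < n)%N.
  rewrite -ltnS (leq_trans _ sn)// ltnS size_filter -(count_predC (fun j => `[< B i `&` B j = set0 >]) s).
  rewrite -[ltnLHS]addn0 ltn_add2l -has_count; apply/hasP; exists i => //=.
  apply/asboolP; rewrite setIid => Bi0.
  by have := dball_center XN (z i) _ (r_gt0 i); rewrite Bi0.
have s'P j : j \in s' -> ((lam * r j)%:E <= \int[mu]_(y in B j) g y)%E.
  by rewrite mem_filter => /andP[_ /sP].
have US : \bigcup_(j in [set` s]) B j `<=`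
    ball (z i) (k * r i) `|` \bigcup_(j in [set` s']) B j.
  move=> x [j js jx]; have [Bij|Bij] := pselect (B i `&` B j = set0).
    by right; exists j => //=; rewrite mem_filter js andbT; apply/asboolP.
  left; rewrite kE; apply: (dball_engulf (z i) (z j) (r i) (r j)) => //; first exact: imax.
  exact/set0P/eqP.
rewrite (le_trans (le_measure _ _ _ US)) ?inE//; first exact: measurableU.
have C0 : 0 < c2 * k / lam by rewrite divr_gt0// mulr_gt0.
have [C CE] : {C | C = c2 * k / lam} by exists (c2 * k / lam).
move: C0 (ih s' s's s'P); rewrite -CE => C0 ih'.
rewrite (le_trans (measureU2 _ _ _))//.
(* The dilated ball has measure at most [c2 * k * r i = C * (lam * r i)], hence at most [C] times
   the integral of [g] over [B i]. *)
apply: (@le_trans _ _ (C%:E * (\int[mu]_(y in B i) g y +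
    \int[mu]_(y in \bigcup_(n in [set` s']) B n) g y)))%E.
  rewrite ge0_muleDr ?integral_ge0// leeD//.
  rewrite (le_trans (measure_dball_le XN _ _ _)) ?mulr_gt0//.
  apply: (@le_trans _ _ (C%:E * (lam * r i)%:E)%E); last first.
    by rewrite lee_wpmul2l ?sP// lee_fin ltW.
  rewrite -EFinM lee_fin CE le_eqVlt; apply/orP; left; apply/eqP.
  by field; rewrite gt_eqF.
rewrite -ge0_integral_setU//.
- rewrite lee_wpmul2l ?lee_fin ?(ltW C0)// ge0_subset_integral//; first exact: measurableU.
  by move=> x [Bx|[j]]; [exists i|rewrite /= mem_filter => /andP[_ js] jx; exists j].
- apply/disj_setPS => x [ix [j]].
  rewrite /= mem_filter => /andP[/asboolP Bij _] jx.
  by have : (B i `&` B j) x by []; rewrite Bij.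
Qed.

Section nonneg.
Context {g : T -> \bar R}.
Hypothesis mg : measurable_fun [set: T] g.
Hypothesis g_ge0 : (forall x, 0 <= g x)%E.

(** Written as a countable union of balls, a superlevel set is measurable and exhausted by finite
    unions, to which [vitali_finite] applies. *)
Lemma ball_maximal_gtE (y : \bar R) : [set x | (y < M g x)%E] =
  \bigcup_(n in [set n | (y < (r n)^-1%:E * \int[mu]_(t in B n) g t)%E]) B n.
Proof.
apply/seteqP; split => [x /= /ereal_sup_gt[_ /= [n xn <-] yn]|x [n /= yn xn]].
  by exists n.
by rewrite (lt_le_trans yn)//; apply: ereal_sup_ubound; exists n.
Qed.

Lemma measurable_ball_maximal_gt (y : \bar R) : measurable [set x | (y < M g x)%E].
Proof. by rewrite ball_maximal_gtE; exact: bigcup_measurable. Qed.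

Lemma measurable_ball_maximal : measurable_fun [set: T] (M g).
Proof.
apply: (measurability _ (ErealGenOInfty.measurableE R)) => _ [_ [x ->] <-].
rewrite setTI (_ : _ @^-1` _ = [set t | (x%:E < M g t)%E]).
  exact: measurable_ball_maximal_gt.
by apply/seteqP; split => t /=; rewrite in_itv/= ?andbT.
Qed.

(** The balls selected among the first [N] indices obey [vitali_finite] uniformly in [N]; continuity
    of the measure from below gives the whole superlevel set. *)
Lemma ball_maximal_weak (lam : R) : 0 < lam ->
  (mu [set x | (lam%:E < M g x)%E] <=
    (c2 * (tau * (1 + 2 * tau)) / lam)%:E * \int[mu]_x g x)%E.
Proof.
move=> lam0; have t0 := tau_gt0 XN; have c0 := c2_gt0 XN.
rewrite ball_maximal_gtE; set P := mkset _.
pose s N := [seq n <- iota 0 N | `[< P n >]].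
have mU (s' : seq nat) : measurable (\bigcup_(n in [set` s']) B n).
  exact: fin_bigcup_measurable.
have -> : \bigcup_(n in P) B n = \bigcup_N \bigcup_(n in [set` s N]) B n.
  apply/seteqP; split => [x [n Pn xn]|x [N _ [n]]].
    exists n.+1 => //; exists n => //=; rewrite mem_filter mem_iota/= add0n ltnSn andbT.
    exact/asboolP.
  by rewrite /= mem_filter => /andP[/asboolP Pn _] xn; exists n.
have/nondecreasing_cvg_mu cvgU : {homo (fun N => \bigcup_(n in [set` s N]) B n) :
    n m / (n <= m)%N >-> (n <= m)%O}.
  move=> n m nm; rewrite subsetEset => x [k]; rewrite /= mem_filter mem_iota/= add0n => /andP[Pk kn] xk.
  by exists k => //=; rewrite mem_filter Pk mem_iota/= add0n (leq_trans kn).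
have {}cvgU := cvgU _ mu (fun N => mU (s N)) (bigcupT_measurable _ (fun N => mU (s N))).
rewrite -(cvg_lim _ cvgU)//; apply: lime_le; first by apply/cvg_ex; eexists; exact: cvgU.
apply: nearW => N /=.
have sP n : n \in s N -> ((lam * r n)%:E <= \int[mu]_(y in B n) g y)%E.
  rewrite mem_filter => /andP[/asboolP + _]; rewrite /P/= => /ltW.
  by rewrite lee_pdivlMl// -EFinM mulrC.
rewrite (le_trans (vitali_finite g lam _ lam0 mg g_ge0 sP))//.
rewrite lee_wpmul2l ?lee_fin ?ge0_subset_integral//.
by rewrite divr_ge0 ?mulr_ge0 ?addr_ge0 ?mulr_ge0// ltW.
Qed.

(** As [mu (B n) <= c2 * r n], a constant [t] contributes at most [c2 * t] to a mean normalised by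
    the radius. *)
Lemma ball_maximal_le_add (g1 : T -> \bar R) (t : R) x : 0 <= t ->
  measurable_fun [set: T] g1 -> (forall x, 0 <= g1 x)%E ->
  (forall x, g x <= g1 x + t%:E)%E -> (M g x <= M g1 x + (c2 * t)%:E)%E.
Proof.
move=> t0 mg1 g10 gg1; apply: ge_ereal_sup => _ [n /= xn <-].
apply: (@le_trans _ _ ((r n)^-1%:E * (\int[mu]_(y in B n) g1 y) + (c2 * t)%:E))%E; last first.
  by rewrite leeD2r//; apply: ereal_sup_ubound; exists n.
have rn0 := r_gt0 n.
rewrite lee_pdivrMl// muleDr//; last first.
  by rewrite ge0_adde_def// inE ?mule_ge0 ?integral_ge0 ?lee_fin ?invr_ge0 ?mulr_ge0// ltW// (c2_gt0 XN).
rewrite muleA -EFinM mulfV ?gt_eqF// mul1e -EFinM.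
apply: (@le_trans _ _ (\int[mu]_(y in B n) (g1 y + t%:E)))%E.
  apply: ge0_le_integral => //; [exact: measurable_funTS|].
  by apply: emeasurable_funD => //; exact: measurable_funTS.
rewrite ge0_integralD//; last exact: measurable_funTS.
rewrite leeD2l// integral_cst// (le_trans (lee_wpmul2l _ (measure_dball_le XN _ _ rn0)))//.
by rewrite -EFinM lee_fin; lra.
Qed.

Hypothesis cover : forall x rho, 0 < rho ->
    exists2 n, ball x rho `<=` B n & r n <= 4 * tau * rho.

(** The covering property puts every point in some ball of the family; a supremum over no ball would
    be [-oo]. *)
Lemma ball_maximal_ge0 x : (0 <= M g x)%E.
Proof.
have [n xn _] := cover x 1 ltr01.
apply: (@le_trans _ _ ((r n)^-1%:E * \int[mu]_(y in B n) g y)%E).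
  by rewrite mule_ge0 ?integral_ge0// lee_fin invr_ge0 ltW.
apply: ereal_sup_ubound; exists n => //=; apply: xn.
exact: dball_center XN _ _ _.
Qed.

Lemma integral_dball_le_maximal x rho : 0 < rho ->
  (\int[mu]_(y in ball x rho) g y <= (4 * tau * rho)%:E * M g x)%E.
Proof.
move=> rho0; have [n xn rn] := cover x rho rho0.
have t0 := tau_gt0 XN.
apply: (@le_trans _ _ ((r n)%:E * M g x)%E); last first.
  by rewrite lee_wpmul2r ?ball_maximal_ge0// lee_fin.
rewrite -lee_pdivrMl//.
apply: (@le_trans _ _ ((r n)^-1%:E * \int[mu]_(y in B n) g y)%E).
  apply: lee_wpmul2l; first by rewrite lee_fin invr_ge0 ltW.
  by apply: ge0_subset_integral => //; exact: measurable_funTS.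
apply: ereal_sup_ubound; exists n => //=; apply: xn.
exact: dball_center XN _ _ _.
Qed.

End nonneg.
End ball_maximal_theory.

(** * Annuli, and kernels satisfying the Harnack condition *)

Lemma expr_lt_eps {R : realType} (q e : R) : 0 < q -> q < 1 -> 0 < e ->
  exists n, q ^+ n < e.
Proof.
move=> q0 q1 e0; have /cvgrPdist_lt /(_ _ e0) : q ^+ n @[n --> \oo] --> 0.
  by apply: cvg_expr; rewrite ger0_norm// ltW.
move=> [n _ /(_ n (leqnn n))] /=; rewrite sub0r normrN ger0_norm ?exprn_ge0 1?ltW//.
by exists n.
Qed.

Section annuli.
Context {R : realType} {d : measure_display} {T : measurableType d}.
Context {delta : T -> T -> R} {mu : {measure set T -> \bar R}}.
Context {tau c1 c2 : R}.
Hypothesis XN : space_N delta mu tau c1 c2.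
Local Notation ball := (dball delta).
Local Notation annulus := (dannulus delta).
Let mball := measurable_dball XN.
Hint Resolve mball : core.
Let q := c1 / (2 * c2).

Lemma ratio_gt0 : 0 < q.
Proof. by rewrite /q divr_gt0 ?mulr_gt0 ?(c1_gt0 XN) ?(c2_gt0 XN). Qed.

Lemma ratio_lt1 : q < 1.
Proof.
have c0 := c1_gt0 XN; have c12 := c1_lt_c2 XN.
by rewrite /q ltr_pdivrMr; lra.
Qed.

Lemma measurable_dannulus x a b : measurable (annulus x a b).
Proof. exact: measurableD. Qed.
Hint Resolve measurable_dannulus : core.

(** For [p <= q] the inner ball has measure at most [c2 * p * r <= c1 * r / 2], half of the lower
    bound for the outer ball. *)
Lemma measure_dannulus_ge x p r : 0 < p -> p <= q -> 0 < r ->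
  ((c1 * r / 2)%:E <= mu (annulus x (p * r) r))%E.
Proof.
move=> p0 pq r0; have c0 := c2_gt0 XN.
have h : ((c1 * r)%:E <= mu (annulus x (p * r) r) + (c1 * r / 2)%:E)%E.
  rewrite (le_trans (measure_dball_ge XN x _ r0))//.
  apply: (@le_trans _ _ (mu (annulus x (p * r) r) + mu (ball x (p * r))))%E.
    rewrite (le_trans _ (measureU2 _ _ _))// le_measure ?inE//; first exact: measurableU.
    by move=> y yr; have [?|?] := pselect (ball x (p * r) y); [right|left].
  rewrite leeD2l// (le_trans (measure_dball_le XN _ _ _)) ?mulr_gt0// lee_fin.
  have : c2 * p <= c1 / 2.
    by move: pq; rewrite /q ler_pdivlMr ?mulr_gt0// => ?; lra.
  by rewrite -(ler_pM2r r0) => h; rewrite mulrA (le_trans h)//; lra.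
move: h; rewrite -leeBlDr// -EFinB => /(le_trans _); apply.
by rewrite lee_fin; lra.
Qed.

Lemma exists_dannulus x r : 0 < r -> exists y, annulus x (q * r) r y.
Proof.
move=> r0; apply/set0P/eqP => A0; have := measure_dannulus_ge x _ _ ratio_gt0 (lexx _) r0.
rewrite A0 measure0 lee_fin leNgt => /negP; apply.
by rewrite divr_gt0// mulr_gt0// (c1_gt0 XN).
Qed.

Section kernel_at.
Context {k : T -> R} {x : T} {gamma H : R}.
Hypothesis k_ge0 : forall y, 0 <= k y.
Hypothesis mk : measurable_fun setT k.
Hypothesis int_k : (\int[mu]_y (k y)%:E <= 1)%E.
Hypothesis H_ge1 : 1 <= H.
Hypothesis gamma_gt0 : 0 < gamma.
Hypothesis gamma_le : gamma <= q ^+ 2.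
Hypothesis harnack : forall r, 0 < r -> forall y y',
  annulus x (gamma * r) r y -> annulus x (gamma * r) r y' -> k y <= H * k y'.

Let gamma_le_q : gamma <= q.
Proof. by rewrite (le_trans gamma_le)// expr2 ger_pMl ?ratio_gt0// ltW// ratio_lt1. Qed.

Let mEk D : measurable_fun D (EFin \o k).
Proof. by apply/measurable_EFinP; exact: measurable_funTS. Qed.
Let k_ge0E y : (0 <= (k y)%:E)%E. Proof. by rewrite lee_fin. Qed.

(** Integrate [k y <= H * k t] over [t] in the annulus, whose measure is at least [c1 * r / 2]. *)
Lemma kernel_le_average r y : 0 < r -> annulus x (gamma * r) r y ->
  ((k y * (c1 * r / 2))%:E <= H%:E * \int[mu]_(t in annulus x (gamma * r) r) (k t)%:E)%E.
Proof.
move=> r0 yA; have H0 : 0 <= H by exact: le_trans H_ge1.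
apply: (@le_trans _ _ ((k y)%:E * mu (annulus x (gamma * r) r)))%E.
  by rewrite EFinM lee_wpmul2l// measure_dannulus_ge.
rewrite -ge0_integralZl_EFin// -integral_cst//.
apply: ge0_le_integral => //.
  by move=> t _ /=.
  exact: measurable_funeM.
by move=> t tA; rewrite -EFinM lee_fin; exact: (harnack _ r0).
Qed.

(* On each annulus the kernel is comparable with its mean, and the annulus
   fills a fixed proportion of its ball. *)
Lemma kernel_dball_le (g : T -> R) e rho : (forall y, 0 <= g y) ->
  measurable_fun setT g -> 0 <= e -> 0 < rho ->
  (forall r, 0 < r -> r <= rho -> (\int[mu]_(y in ball x r) (g y)%:E <= (e * r)%:E)%E) ->
  (\int[mu]_(y in ball x rho) (k y * g y)%:E <= (2 * H / c1 * e)%:E)%E.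
Proof.
move=> g0 mg e0 rho0 hg; have c0 := c1_gt0 XN.
have H0 : 0 <= H by exact: le_trans H_ge1.
have q0 := ratio_gt0; have q1 := ratio_lt1; have gq := gamma_le_q.
have gamma1 : gamma < 1 by exact: le_lt_trans q1.
have mkg : measurable_fun setT (fun y => (k y * g y)%:E).
  by apply/measurable_EFinP; exact: measurable_funM.
have mEg D : measurable_fun D (EFin \o g).
  by apply/measurable_EFinP; exact: measurable_funTS.
have kg0 y : (0 <= (k y * g y)%:E)%E by rewrite lee_fin mulr_ge0.
pose rn n := gamma ^+ n * rho.
have rn0 n : 0 < rn n by rewrite /rn mulr_gt0// exprn_gt0.
have rnS n : rn n.+1 = gamma * rn n by rewrite /rn exprS mulrA.
have rn_le n : rn n <= rho by rewrite /rn ger_pMl// exprn_ile1// ltW.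
have rn_nincr m n : (m <= n)%N -> rn n <= rn m.
  by move=> mn; rewrite /rn ler_pM2r// ler_wiXn2l// ltW.
pose A n := annulus x (rn n.+1) (rn n).
have mA n : measurable (A n) by exact: measurable_dannulus.
(* The annuli of ratio [gamma] shrink to the centre, the only point of the ball that they miss, and
   that point is null. *)
have UA : ball x rho = [set x] `|` \bigcup_n A n.
  apply/seteqP; split => [y yrho|y [->|[n _ [yn _]]]]; last 2 first.
  - exact: dball_center XN _ _ _.
  - exact: (dball_mono _ _ _ (rn_le n)) yn.
  have [<-|xy] := pselect (x = y); [by left|right].
  have dxy : 0 < delta x y.
    rewrite lt_neqAle (delta_ge0 XN) andbT; apply/eqP => dxy; apply: xy.
    by apply: (delta_eq0 XN).
  have [m hm] : exists m, ~~ (delta x y < rn m).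
    have [m hm] := expr_lt_eps _ _ gamma_gt0 gamma1 (divr_gt0 dxy rho0).
    by exists m; rewrite -leNgt /rn -ler_pdivlMr// ltW.
  (* The least exponent with [rn m <= delta x y] is positive because [y] lies in the ball; its
     predecessor indexes the annulus containing [y]. *)
  have [m' hm' minm'] := @ex_minnP (fun m => ~~ (delta x y < rn m)) (ex_intro _ m hm).
  case: m' hm' minm' => [|n] hn minn.
    by move: hn yrho; rewrite /rn expr0 mul1r /dball/= => /negP.
  exists n => //; split; last exact/negP.
  by rewrite /dball/=; apply: contrapT => /negP/minn; rewrite ltnn.
have tA : trivIset setT A.
  apply/trivIsetP => i j _ _; wlog ij : i j / (i < j)%N.
    move=> wl; rewrite neq_ltn => /orP[ij|ji]; first by apply: wl => //; rewrite neq_ltn ij.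
    by rewrite setIC; apply: wl => //; rewrite neq_ltn ji.
  move=> _; apply/seteqP; split => // y [[_ yi] [yj _]]; apply: yi.
  exact: (dball_mono _ _ _ (rn_nincr _ _ ij)) yj.
have mUA : measurable (\bigcup_n A n) by exact: bigcupT_measurable.
have m1 := measurable_set1_space XN x.
rewrite UA ge0_integral_setU//; last 2 first.
- exact: measurable_funTS.
- apply/disj_setPS => y [/= -> [n _ [_]]]; apply.
  exact: dball_center XN _ _ _.
rewrite (null_set_integral m1)//; [|exact: measurable_funTS|exact: measure_point XN x].
rewrite add0e ge0_integral_bigcup//; last exact: measurable_funTS.
(* On [A n] the kernel is at most a multiple of its mass there divided by [rn n], while [g] has
   integral at most [e * rn n]. The factor [rn n] cancels, and the masses over the annuli sum to at
   most 1. *)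
apply: (@le_trans _ _ (\sum_(0 <= n <oo) ((2 * H / c1 * e)%:E * \int[mu]_(y in A n) (k y)%:E)))%E.
  apply: lee_nneseries => n _; first by move=> _; exact: integral_ge0.
  have fin : (\int[mu]_(y in A n) (k y)%:E)%E \is a fin_num.
    rewrite ge0_fin_numE ?integral_ge0// (@le_lt_trans _ _ 1%E) ?ltry//.
    by rewrite (le_trans _ int_k)// ge0_subset_integral.
  pose I := fine (\int[mu]_(y in A n) (k y)%:E)%E.
  have IE : (\int[mu]_(y in A n) (k y)%:E)%E = I%:E by rewrite fineK.
  have I0 : 0 <= I by rewrite fine_ge0// integral_ge0.
  pose S := 2 * H / (c1 * rn n) * I.
  have S0 : 0 <= S.
    by apply: mulr_ge0 => //; apply: divr_ge0; [exact: mulr_ge0|exact/ltW/mulr_gt0].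
  have kS y : A n y -> k y <= S.
    move=> yA; have : annulus x (gamma * rn n) (rn n) y by rewrite -rnS.
    move=> /(kernel_le_average _ _ (rn0 n)); rewrite -rnS -/(A n) IE -EFinM lee_fin.
    rewrite -ler_pdivlMr; last by apply: divr_gt0 => //; exact: mulr_gt0.
    move=> /le_trans; apply.
    rewrite /S le_eqVlt; apply/orP; left; apply/eqP.
    by field; rewrite !gt_eqF.
  apply: (@le_trans _ _ (\int[mu]_(y in A n) (S%:E * (g y)%:E)))%E.
    apply: ge0_le_integral => //; first exact: measurable_funTS.
      exact: measurable_funeM.
    by move=> y yA; rewrite -EFinM lee_fin ler_wpM2r// kS.
  rewrite ge0_integralZl_EFin//; last by move=> y _; rewrite lee_fin.
  apply: (@le_trans _ _ (S%:E * (e * rn n)%:E)%E).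
    rewrite lee_wpmul2l ?lee_fin// (le_trans _ (hg _ (rn0 n) (rn_le n)))//.
    apply: ge0_subset_integral => //; first by move=> y _; rewrite lee_fin.
    by move=> y [].
  rewrite IE -!EFinM lee_fin /S le_eqVlt; apply/orP; left; apply/eqP.
  by field; rewrite !gt_eqF.
have C0 : 0 <= 2 * H / c1 * e by rewrite mulr_ge0// divr_ge0 ?mulr_ge0// ltW.
rewrite nneseriesZl; last by move=> n _; exact: integral_ge0.
rewrite -ge0_integral_bigcup// -[leRHS]mule1 lee_wpmul2l ?lee_fin//.
by rewrite (le_trans _ int_k)// ge0_subset_integral.
Qed.

(** The constant in [kernel_dball_le] does not depend on [rho], so monotone convergence along balls
    of integer radius makes the estimate global. *)
Lemma kernel_integral_le (g : T -> R) e : (forall y, 0 <= g y) ->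
  measurable_fun setT g -> 0 <= e ->
  (forall r, 0 < r -> (\int[mu]_(y in ball x r) (g y)%:E <= (e * r)%:E)%E) ->
  (\int[mu]_y (k y * g y)%:E <= (2 * H / c1 * e)%:E)%E.
Proof.
move=> g0 mg e0 hg.
have mkg : measurable_fun setT (fun y => (k y * g y)%:E).
  by apply/measurable_EFinP; exact: measurable_funM.
have nd : {homo (fun n => ball x n%:R) : n m / (n <= m)%N >-> (n <= m)%O}.
  by move=> n m nm; rewrite subsetEset; apply: dball_mono; rewrite ler_nat.
rewrite -(@bigcup_dball _ _ _ delta x).
have cv := @ge0_nondecreasing_set_cvg_integral _ _ _ _ (fun y => (k y * g y)%:E)
  mu nd (fun n => mball x n%:R) (fun n => measurable_funTS mkg)
  (fun n y _ => mulr_ge0 (k_ge0 y) (g0 y)).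
rewrite -(cvg_lim _ cv)//; apply: lime_le; first by apply/cvg_ex; eexists; exact: cv.
near=> n; apply: kernel_dball_le => //; last by move=> r r0 _; exact: hg.
by rewrite ltr0n; near: n; exact: nbhs_infty_gt.
Unshelve. all: by end_near. Qed.

End kernel_at.
End annuli.

(** * Decay of the kernels away from the diagonal *)

Lemma geometric_nneseries_le {R : realType} (a p : R) : 0 <= a -> 0 <= p -> p < 1 ->
  (\sum_(0 <= n <oo) (a * p ^+ n)%:E <= (a / (1 - p))%:E)%E.
Proof.
move=> a0 p0 p1; have p10 : 0 < 1 - p by rewrite subr_gt0.
apply: lime_le.
  by apply: is_cvg_nneseries => n _ _; rewrite lee_fin mulr_ge0// exprn_ge0.
apply: nearW => N; rewrite sumEFin lee_fin.
suff -> : \sum_(0 <= n < N) a * p ^+ n = a * (1 - p ^+ N) / (1 - p).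
  by rewrite ler_wpM2r ?invr_ge0 ?(ltW p10)// ler_piMr// gerBl exprn_ge0.
elim: N => [|N ih]; first by rewrite big_geq// expr0 subrr mulr0 mul0r.
by rewrite big_nat_recr//= ih exprS; field; rewrite gt_eqF.
Qed.

Lemma powR2_gt1 {R : realType} (p : R) : 0 < p -> 1 < 2 `^ p :> R.
Proof.
move=> p0; have := gt0_ltr_powR p0 (_ : 1 \in Num.nneg) (_ : 2 \in Num.nneg) (ltr1n R 2).
by rewrite powR1; apply; rewrite nnegrE.
Qed.

Lemma measurable_kernel_section {R : realType} {d : measure_display}
    {T : measurableType d} (mu : {measure set T -> \bar R}) (K : T -> T -> R) x :
  sym_markov_kernel mu K -> measurable_fun setT (K x).
Proof. by case=> _ _ mK _; exact: (measurableT_comp mK (measurable_pair1 x)). Qed.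

Section concentration.
Context {R : realType} {d : measure_display} {T : measurableType d}.
Context {delta : T -> T -> R} {mu : {measure set T -> \bar R}}.
Context {tau c1 c2 : R}.
Hypothesis XN : space_N delta mu tau c1 c2.
Local Notation ball := (dball delta).
Local Notation annulus := (dannulus delta).
Let mball := measurable_dball XN.
Hint Resolve mball : core.
Let q := c1 / (2 * c2).

Lemma powR_opp_le (a b p : R) : 0 < a -> a <= b -> 0 <= p -> b `^ (- p) <= a `^ (- p).
Proof.
move=> a0 ab p0; have b0 : 0 < b by exact: lt_le_trans ab.
by rewrite !powRN lef_pV2 ?posrE ?powR_gt0// ge0_ler_powR// nnegrE ltW.
Qed.

(* The annuli at scales rho and rho / q overlap because gamma <= q ^ 2. *)
Lemma in_S_step (K : T -> T -> R) (gamma H s A R0 : R) :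
  1 <= H -> 0 < gamma -> gamma <= q ^+ 2 -> in_Ha delta gamma H K ->
  0 < s -> 0 <= A -> 0 < R0 -> in_S delta s A R0 K -> in_S delta s (H * A) (q * R0) K.
Proof.
move=> H1 g0 gq HK s0 A0 R00 SK x y xy.
have q0 := ratio_gt0 XN; have q1 := ratio_lt1 XN; rewrite -/q in q0 q1.
have rho0 : 0 < delta x y by rewrite (lt_trans _ xy)// mulr_gt0.
(* This outer radius puts [y] on the inner boundary of its annulus of ratio [gamma]. *)
have r0 : 0 < delta x y / gamma by rewrite divr_gt0.
have gq' : gamma < q by rewrite (le_lt_trans gq)// expr2 gtr_pMr.
have rE : gamma * (delta x y / gamma) = delta x y by rewrite mulrC divfK// gt_eqF.
(* The comparison point [y'] comes from the thinner annulus of ratio [q]. As [gamma <= q ^+ 2], its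
   distance to [x] is at least [delta x y / q], which exceeds [R0], so the known decay applies to
   it. *)
have [y' [y'r /negP]] := exists_dannulus XN x _ r0; rewrite -/q -leNgt => qy'.
have qr : delta x y / q <= q * (delta x y / gamma).
  rewrite ler_pdivrMr// (_ : q * _ * q = q ^+ 2 * delta x y / gamma); last by ring.
  by rewrite ler_pdivlMr// mulrC ler_pM2r.
have R0y' : R0 < delta x y' by rewrite (lt_le_trans _ qy')// (lt_le_trans _ qr)// ltr_pdivlMr// mulrC.
have yy' : delta x y <= delta x y'.
  by rewrite (le_trans _ qy')// (le_trans _ qr)// ler_pdivlMr// ger_pMr// ltW.
have yA : annulus x (gamma * (delta x y / gamma)) (delta x y / gamma) y.
  split; rewrite /dball/= ?rE ?ltxx//.
  by rewrite ltr_pdivlMr// gtr_pMr// (lt_trans gq').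
have y'A : annulus x (gamma * (delta x y / gamma)) (delta x y / gamma) y'.
  by split; rewrite /dball/= ?rE//; apply/negP; rewrite -leNgt.
rewrite (le_trans (HK _ _ r0 _ _ yA y'A))//.
have H0 : 0 < H by exact: lt_le_trans H1.
rewrite -mulrA ler_pM2l// (le_trans (SK _ _ R0y'))//.
by rewrite ler_wpM2l// powR_opp_le// addr_ge0// ltW.
Qed.

(** Cut the tail into dyadic shells of radii [rn n]. The kernel is bounded there by the power -(1 +
    s) of the radius and the shell has measure at most linear in it, so the contributions form a
    geometric series of ratio 2^(-s). *)
Lemma tail_integral_le (k : T -> R) x (A s lam : R) :
  (forall y, 0 <= k y) -> measurable_fun setT k -> 0 <= A -> 0 < s -> 0 < lam ->
  (forall y, lam <= delta x y -> k y <= A * (delta x y) `^ (- (1 + s))) ->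
  (\int[mu]_(y in [set y | (lam <= delta x y)%R]) (k y)%:E <=
   (A * (2 * c2 * lam `^ (- s) / (1 - 2 `^ (- s))))%:E)%E.
Proof.
move=> k0 mk A0 s0 lam0 kA; have c0 := c2_gt0 XN.
pose rn n := 2 ^+ n * lam.
have rn0 n : 0 < rn n by rewrite /rn mulr_gt0// exprn_gt0.
have rnS n : rn n.+1 = 2 * rn n by rewrite /rn exprS mulrA.
have rn_ge n : lam <= rn n by rewrite /rn ler_peMl ?exprn_ege1 ?ler1n// ltW.
have rn_ndecr m n : (m <= n)%N -> rn m <= rn n.
  by move=> mn; rewrite /rn ler_pM2r// ler_weXn2l// ler1n.
pose D n := annulus x (rn n) (rn n.+1).
have mD n : measurable (D n) by exact: (measurable_dannulus XN).
have UD : [set y | lam <= delta x y] = \bigcup_n D n.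
  apply/seteqP; split => [y/= ly|y [n _ [_ /negP]]]; last first.
    by rewrite -leNgt; exact: le_trans.
  have [m hm] : exists m, delta x y < rn m.
    have dy0 : 0 < delta x y by exact: lt_le_trans ly.
    have h0 : 0 < 2^-1 :> R by rewrite invr_gt0.
    have h1 : 2^-1 < 1 :> R by rewrite invf_lt1 ?ltr1n.
    have [m hm] := expr_lt_eps _ _ h0 h1 (divr_gt0 lam0 dy0).
    exists m; rewrite /rn mulrC -ltr_pdivrMr ?exprn_gt0//.
    move: hm; rewrite ltr_pdivlMr// exprVn mulrC; exact.
  have [m' hm' minm'] := @ex_minnP (fun m => delta x y < rn m) (ex_intro _ m hm).
  case: m' hm' minm' => [|n] hn minn.
    by move: hn; rewrite /rn expr0 mul1r ltNge ly.
  exists n => //; split; first exact: hn.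
  by rewrite /dball/= => /minn; rewrite ltnn.
have tD : trivIset setT D.
  apply/trivIsetP => i j _ _; wlog ij : i j / (i < j)%N.
    move=> wl; rewrite neq_ltn => /orP[ij|ji]; first by apply: wl => //; rewrite neq_ltn ij.
    by rewrite setIC; apply: wl => //; rewrite neq_ltn ji.
  move=> _; apply/seteqP; split => // y [[yi _] [_ yj]]; apply: yj.
  exact: (dball_mono _ _ _ (rn_ndecr _ _ ij)) yi.
have mEk E : measurable_fun E (EFin \o k).
  by apply/measurable_EFinP; exact: measurable_funTS.
have k0E y : (0 <= (k y)%:E)%E by rewrite lee_fin.
rewrite UD ge0_integral_bigcup//.
have p1 : 2 `^ (- s) < 1 :> R.
  by rewrite powRN invf_lt1 ?powR2_gt1// powR_gt0.
have e0 : 0 <= A * (2 * c2 * lam `^ (- s)).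
  by apply: mulr_ge0 => //; rewrite mulr_ge0 ?powR_ge0// mulr_ge0// ltW.
rewrite (mulrA A).
apply: le_trans (geometric_nneseries_le _ _ e0 (powR_ge0 _ _) p1).
apply: lee_nneseries => n _; first by move=> _; exact: integral_ge0.
apply: (@le_trans _ _ (\int[mu]_(y in D n) (A * rn n `^ (- (1 + s)))%:E)%E).
  apply: ge0_le_integral => // y [_ /negP]; rewrite -leNgt => rny.
  rewrite lee_fin (le_trans (kA _ (le_trans (rn_ge n) rny)))//.
  by rewrite ler_wpM2l// powR_opp_le// addr_ge0// ltW.
rewrite integral_cst//.
apply: (@le_trans _ _ ((A * rn n `^ (- (1 + s)))%:E * (c2 * rn n.+1)%:E)%E).
  rewrite lee_wpmul2l ?lee_fin ?mulr_ge0 ?powR_ge0//.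
  rewrite (le_trans _ (measure_dball_le XN x _ (rn0 n.+1)))// le_measure ?inE//.
  by move=> y [].
rewrite -EFinM lee_fin le_eqVlt; apply/orP; left; apply/eqP.
have -> : 2 `^ (- s) ^+ n = (2 ^+ n) `^ (- s) :> R.
  by rewrite -powR_mulrn ?powR_ge0// -powRrM mulrC powRrM powR_mulrn.
have -> : A * (2 * c2 * lam `^ (- s)) * (2 ^+ n) `^ (- s) = A * 2 * c2 * rn n `^ (- s).
  by rewrite /rn powRM ?exprn_ge0// ?ltW//; ring.
have -> : rn n `^ (- s) = rn n `^ (- (1 + s)) * rn n.
  rewrite -[X in _ * X]powRr1 ?ltW// -powRD; last by rewrite (gt_eqF (rn0 n)) implybT.
  by congr (_ `^ _); ring.
by rewrite rnS; ring.
Qed.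

End concentration.

(** * Domination of the maximal operator of the kernels *)

Section maximal_operator.
Context {R : realType} {d : measure_display} {T : measurableType d}.
Context {delta : T -> T -> R} {mu : {measure set T -> \bar R}}.
Context {tau c1 c2 : R} {K : R -> T -> T -> R} {gamma H : R}.
Hypothesis XN : space_N delta mu tau c1 c2.
Context {z : nat -> T} {r : nat -> R}.
Hypothesis r_gt0 : forall n, 0 < r n.
Hypothesis cover : forall x rho, 0 < rho ->
    exists2 n, dball delta x rho `<=` dball delta (z n) (r n) & r n <= 4 * tau * rho.
Hypothesis KM : forall a, 0 < a < 1 -> sym_markov_kernel mu (K a).
Hypothesis H_ge1 : 1 <= H.
Hypothesis gamma_gt0 : 0 < gamma.
Hypothesis gamma_le : gamma <= (c1 / (2 * c2)) ^+ 2.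
Hypothesis KH : forall a, 0 < a < 1 -> in_Ha delta gamma H (K a).
Local Notation M := (ball_maximal delta mu z r).

(** If the ball maximal function has the finite value [m] at [x], the integrals of |f| over balls
    around [x] satisfy the hypothesis of [kernel_integral_le] with [e = 4 * tau * m], whatever the
    kernel of the family. *)
Lemma max_op_le_ball_maximal (f : T -> R) x : measurable_fun setT f ->
  (max_op mu K f x <= (8 * H * tau / c1)%:E * M (fun y => (`|f y|)%:E) x)%E.
Proof.
move=> mf; have c0 := c1_gt0 XN; have t0 := tau_gt0 XN.
have H0 : 0 < H by exact: lt_le_trans H_ge1.
have mnf : measurable_fun setT (fun y => `|f y|) by exact: measurableT_comp.
have mnfE : measurable_fun setT (fun y => (`|f y|)%:E) by exact/measurable_EFinP.
have nf0 y : (0 <= (`|f y|)%:E)%E by rewrite lee_fin.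
have M0 := ball_maximal_ge0 XN r_gt0 nf0 cover x.
have C0 : 0 < 8 * H * tau / c1 by rewrite divr_gt0// !mulr_gt0.
have := integral_dball_le_maximal XN r_gt0 mnfE nf0 cover x.
case: (M _ x) M0 => [m| |//] m0 hm; last by rewrite gt0_muley ?leey// lte_fin.
apply: ge_ereal_sup => _ [a /= a01 <-].
have {}a01 : 0 < a < 1 by move: a01; rewrite in_itv.
have mk := measurable_kernel_section mu (K a) x (KM a a01).
have [k0 _ _ k1] := KM a a01.
rewrite /kernel_op (le_trans (le_abse_integral _ _ _))//.
  by apply/measurable_EFinP; exact: measurable_funM.
have -> : (\int[mu]_y `|(K a x y * f y)%:E| = \int[mu]_y (K a x y * `|f y|)%:E)%E.
  by apply: eq_integral => y _; rewrite /= normrM (ger0_norm (k0 x y)).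
have -> : ((8 * H * tau / c1)%:E * m%:E = (2 * H / c1 * (4 * tau * m))%:E)%E.
  by rewrite -EFinM; congr EFin; field; rewrite gt_eqF.
apply: (kernel_integral_le XN (k0 x) mk _ H_ge1 gamma_gt0 gamma_le) => //.
- by rewrite k1.
- by move=> rho rho0 y y'; exact: KH.
- by rewrite !mulr_ge0// ltW.
- move=> rho rho0; rewrite (le_trans (hm rho rho0))// -EFinM lee_fin.
  by rewrite le_eqVlt; apply/orP; left; apply/eqP; ring.
Qed.

End maximal_operator.

(** * From weak estimates for truncations to L^p estimates *)

Lemma dyadic_powR {R : realType} (a p : R) n : 0 < a ->
  (2 ^+ n * a) `^ p = a `^ p * (2 `^ p) ^+ n.
Proof.
move=> a0; rewrite powRM ?exprn_ge0 ?(ltW a0)// mulrC; congr (_ * _).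
by rewrite -[RHS]powR_mulrn ?powR_ge0// -powRrM mulrC powRrM powR_mulrn.
Qed.

(** The terms grow geometrically up to the last level below [V], so their sum is comparable with the
    last of them. *)
Lemma dyadic_sum_le {R : realType} (a p V : R) : 0 < a -> 0 < p -> 0 <= V ->
  (\sum_(0 <= n <oo) ((2 ^+ n * a) `^ p * (2 ^+ n * a < V)%R%:R)%:E <=
   (2 `^ p / (2 `^ p - 1) * V `^ p)%:E)%E.
Proof.
move=> a0 p0 V0; have := powR2_gt1 p p0.
set Q := 2 `^ p => Q1; have Q10 : 0 < Q - 1 by rewrite subr_gt0.
have Q0 : 0 < Q by exact: lt_trans Q1.
have C0 : 0 <= Q / (Q - 1) by rewrite divr_ge0// ltW.
(* The constant reproduces itself in the induction: [Q / (Q - 1) + Q = Q / (Q - 1) * Q]. *)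
have geom m : \sum_(0 <= n < m.+1) (2 ^+ n * a) `^ p <= Q / (Q - 1) * (2 ^+ m * a) `^ p.
  elim: m => [|m ih].
    rewrite big_nat1 ler_peMl ?powR_ge0// ler_pdivlMr// mul1r gerBl//.
  rewrite big_nat_recr//= (le_trans (lerD ih (lexx _)))//.
  rewrite !dyadic_powR// -/Q exprS le_eqVlt; apply/orP; left; apply/eqP.
  by field; rewrite gt_eqF.
apply: lime_le.
  apply: is_cvg_nneseries => n _ _.
  by rewrite lee_fin mulr_ge0// powR_ge0.
apply: nearW => N; rewrite sumEFin lee_fin; elim: N => [|N ih].
  by rewrite big_geq// mulr_ge0// powR_ge0.
(* If level [N] is below [V], drop the indicators and use [geom]; otherwise the new term
   vanishes. *)
have [h|h] := ltP (2 ^+ N * a) V; last first.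
  by rewrite big_nat_recr//= ltNge h/= mulr0 addr0.
apply: (@le_trans _ _ (\sum_(0 <= n < N.+1) (2 ^+ n * a) `^ p)).
  apply: ler_sum => n _; rewrite ler_piMr ?powR_ge0//.
  by case: (_ < _).
rewrite (le_trans (geom N))// ler_wpM2l// ge0_ler_powR ?nnegrE// ?(ltW p0) ?(ltW h)//.
by rewrite mulr_ge0 ?exprn_ge0// ltW.
Qed.

Lemma nneseries_ge_term {R : realType} (u : nat -> \bar R) n :
  (forall k, 0 <= u k)%E -> (u n <= \sum_(0 <= k <oo) u k)%E.
Proof.
move=> u0; apply: le_trans (nneseries_lim_ge n.+1 (fun k _ _ => u0 k)).
by rewrite big_nat_recr//= leeDr// sume_ge0.
Qed.

Section weak_to_strong.
Context {R : realType} {d : measure_display} {T : measurableType d}.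
Context {mu : {measure set T -> \bar R}}.
Context {u : T -> \bar R} {v : T -> R} {A B p : R}.
Hypothesis mu_ : measurable_fun setT u.
Hypothesis u_ge0 : forall x, (0 <= u x)%E.
Hypothesis mv : measurable_fun setT v.
Hypothesis v_ge0 : forall x, 0 <= v x.
Hypothesis A_gt0 : 0 < A.
Hypothesis B_gt0 : 0 < B.
Hypothesis p_gt1 : 1 < p.
Hypothesis weak : forall lam : R, 0 < lam ->
  (mu [set x | (lam%:E < u x)%E] <=
   (A / lam)%:E * \int[mu]_x (v x * \1_[set x | B * lam < v x] x)%:E)%E.

(** The factor 2^p comes from rounding [u] up to twice a dyadic level, [A] from the weak estimate,
    the quotient from summing levels with exponent [p - 1], and the last factor from the truncation
    height [B * lam]. *)
Definition strong_constant := 2 `^ p * A * (2 `^ (p - 1) / (2 `^ (p - 1) - 1)) * (B^-1 `^ (p - 1)).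

Let p_gt0 : 0 < p. Proof. exact: lt_trans p_gt1. Qed.
Let pB_gt0 : 0 < p - 1. Proof. by rewrite subr_gt0. Qed.

Let mE (y : \bar R) : measurable [set x | (y < u x)%E].
Proof. by rewrite -[X in measurable X]setTI; exact: emeasurable_fun_o_infty. Qed.

Let mF (y : R) : measurable [set x | y < v x].
Proof.
rewrite (_ : mkset _ = [set: T] `&` v @^-1` `]y, +oo[); first exact: mv.
by rewrite setTI; apply/seteqP; split => x /=; rewrite in_itv/= andbT.
Qed.

Lemma strong_constant_ge0 : 0 <= strong_constant.
Proof.
rewrite /strong_constant; apply: mulr_ge0; last exact: powR_ge0.
apply: mulr_ge0; first by rewrite mulr_ge0 ?powR_ge0// ltW.
by rewrite divr_ge0 ?powR_ge0// subr_ge0 ltW// powR2_gt1.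
Qed.

(** For finite [u x] one term suffices: [u x] is at most twice the last dyadic level below it. For
    [u x = +oo] every level contributes and the terms are unbounded. *)
Lemma poweR_le_dyadic a x : 0 < a -> (a%:E < u x)%E ->
  (u x `^ p <= \sum_(0 <= n <oo)
     ((2 * (2 ^+ n * a)) `^ p)%:E * (\1_[set x | ((2 ^+ n * a)%:E < u x)%E] x)%:E)%E.
Proof.
move=> a0 aux; set t := (X in (_ <= \sum_(0 <= n <oo) X n)%E).
have t0 n : (0 <= t n)%E by rewrite /t mule_ge0 ?lee_fin ?powR_ge0.
have dyad y : exists n, y <= 2 ^+ n * a.
  pose Y := Num.max y a.
  have Y0 : 0 < Y by rewrite /Y lt_max a0 orbT.
  have h0 : 0 < 2^-1 :> R by rewrite invr_gt0.
  have h1 : 2^-1 < 1 :> R by rewrite invf_lt1 ?ltr1n.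
  have [n hn] := expr_lt_eps _ _ h0 h1 (divr_gt0 a0 Y0).
  exists n; rewrite mulrC -ler_pdivrMr ?exprn_gt0//.
  apply: (@le_trans _ _ (Y * (2^-1) ^+ n)); last first.
    by move: hn; rewrite ltr_pdivlMr// mulrC => /ltW.
  by rewrite exprVn ler_wpM2r ?invr_ge0 ?exprn_ge0// /Y le_max lexx.
have tn n : ((2 ^+ n * a)%:E < u x)%E -> t n = ((2 * (2 ^+ n * a)) `^ p)%:E.
  by move=> h; rewrite /t indicE mem_set// mule1.
case E : (u x) => [y| |]; last by have := u_ge0 x; rewrite E.
- have [m hm] := dyad y.
  have [m' hm' minm'] := @ex_minnP (fun m => y <= 2 ^+ m * a) (ex_intro _ m hm).
  case: m' hm' minm' => [|n] hn minn.
    by move: aux; rewrite E lte_fin ltNge; move: hn; rewrite expr0 mul1r => ->.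
  have hn' : 2 ^+ n * a < y by rewrite ltNge; apply/negP => /minn; rewrite ltnn.
  rewrite (le_trans _ (nneseries_ge_term t n t0))// tn ?E ?lte_fin//.
  rewrite poweR_EFin lee_fin ge0_ler_powR ?nnegrE ?(ltW p_gt0)//.
  + by rewrite (le_trans _ (ltW hn'))// mulr_ge0 ?exprn_ge0// ltW.
  + by rewrite !mulr_ge0 ?exprn_ge0// ltW.
  + by rewrite mulrA -exprS.
- rewrite poweRyr ?gt_eqF//; rewrite leye_eq; apply/eqP/eq_infty => y.
  (* A level of at least 1 is not decreased by the power [p]. *)
  have [n hn] := dyad (Num.max y 1).
  rewrite (le_trans _ (nneseries_ge_term t n t0))// tn ?E ?ltry// lee_fin.
  move: hn; rewrite ge_max => /andP[yn n1].
  have n0 : 0 <= 2 ^+ n * a by rewrite mulr_ge0 ?exprn_ge0// ltW.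
  have n2 : 2 ^+ n * a <= 2 * (2 ^+ n * a) by rewrite ler_peMl// ler1n.
  rewrite (le_trans yn)// (le_trans n2)// le1r_powR ?(ltW p_gt1)//.
  exact: le_trans n2.
Qed.

(** Sum over dyadic levels starting at [a], apply the weak estimate at each level, and interchange
    sum and integral. Points with [0 < u x <= a] lie below every level and are left out; zeros of
    [u] cost nothing and are kept so that the domains exhaust the space as [a] tends to 0. *)
Lemma weak_to_strong_on a : 0 < a ->
  (\int[mu]_(x in [set x | u x = 0%E \/ (a%:E < u x)%E]) (u x `^ p) <=
   strong_constant%:E * \int[mu]_x (v x `^ p)%:E)%E.
Proof.
move=> a0; set D := mkset _.
pose w n := 2 ^+ n * a.
have w0 n : 0 < w n by rewrite /w mulr_gt0 ?exprn_gt0.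
pose E n := [set x | ((w n)%:E < u x)%E].
pose F n := [set x | B * w n < v x].
have mup : measurable_fun setT (fun x => u x `^ p)%E.
  exact: (measurableT_comp (measurable_poweR p) mu_).
have mD : measurable D.
  rewrite /D (_ : mkset _ = (~` [set x | (0 < u x)%E]) `|` [set x | (a%:E < u x)%E]).
    by apply: measurableU => //; exact: measurableC.
  apply/seteqP; split => x /= -[h|h]; [left|by right|left|by right].
    by rewrite h ltxx.
  by apply/eqP; rewrite eq_le u_ge0 andbT leNgt; apply/negP.
have mindE (S : set T) : measurable S -> measurable_fun setT (fun x => (\1_S x)%:E : \bar R).
  by move=> mS; apply/measurable_EFinP; exact: measurable_indic.
apply: (@le_trans _ _ (\int[mu]_x \sum_(0 <= n <oo)
   (((2 * w n) `^ p)%:E * (\1_(E n) x)%:E))%E).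
  have msum : measurable_fun setT (fun x => \sum_(0 <= n <oo)
      (((2 * w n) `^ p)%:E * (\1_(E n) x)%:E))%E.
    apply: ge0_emeasurable_sum => [n x _ _|n _].
      by rewrite mule_ge0 ?lee_fin ?powR_ge0.
    by apply: measurable_funeM; exact: (mindE _ (mE _)).
  apply: (@le_trans _ _ (\int[mu]_(x in D) \sum_(0 <= n <oo)
      (((2 * w n) `^ p)%:E * (\1_(E n) x)%:E))%E).
    apply: ge0_le_integral => //.
    - by move=> x _; exact: poweR_ge0.
    - exact: measurable_funTS.
    - exact: measurable_funTS.
    - move=> x [->|]; last exact: poweR_le_dyadic.
      rewrite poweR0r ?gt_eqF//; apply: nneseries_ge0 => n _ _.
      by rewrite mule_ge0 ?lee_fin ?powR_ge0.
  apply: ge0_subset_integral => // x _; apply: nneseries_ge0 => n _ _.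
  by rewrite mule_ge0 ?lee_fin ?powR_ge0.
rewrite integral_nneseries//; last 2 first.
- by move=> n; apply: measurable_funeM; exact: (mindE _ (mE _)).
- by move=> n x _; rewrite mule_ge0 ?lee_fin ?powR_ge0.
have vF0 n x : 0 <= v x * \1_(F n) x by rewrite mulr_ge0.
have mvF n : measurable_fun setT (fun x => (v x * \1_(F n) x)%:E).
  by apply/measurable_EFinP; apply: measurable_funM => //; exact: (measurable_indic (mF _)).
have k0 n : 0 <= (2 * w n) `^ p * (A / w n) by rewrite mulr_ge0 ?powR_ge0// divr_ge0// ltW.
apply: (@le_trans _ _ (\sum_(0 <= n <oo) \int[mu]_x
    (((2 * w n) `^ p * (A / w n))%:E * (v x * \1_(F n) x)%:E))%E).
  apply: lee_nneseries => n _.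
    move=> _; apply: integral_ge0 => x _.
    by rewrite mule_ge0 ?lee_fin ?powR_ge0.
  rewrite !ge0_integralZl_EFin ?powR_ge0//; last 2 first.
  - by move=> x _; rewrite lee_fin.
  - exact: (mindE _ (mE _)).
  rewrite (integral_indic _ measurableT (mE _)) setIT (EFinM (_ `^ _)) -muleA lee_wpmul2l ?lee_fin ?powR_ge0//.
  exact: weak.
rewrite -integral_nneseries//; last 2 first.
- by move=> n; exact: measurable_funeM.
- by move=> n x _; rewrite mule_ge0 ?lee_fin.
have mvp : measurable_fun setT (fun x => (v x `^ p)%:E).
  by apply/measurable_EFinP; exact: (measurableT_comp (measurable_powR p) mv).
rewrite -ge0_integralZl_EFin ?strong_constant_ge0//; last by move=> x _; rewrite lee_fin powR_ge0.
apply: ge0_le_integral => //.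
- move=> x _; apply: nneseries_ge0 => n _ _.
  by rewrite mule_ge0 ?lee_fin.
- apply: ge0_emeasurable_sum => [n x _ _|n _]; last exact: measurable_funeM.
  by rewrite mule_ge0 ?lee_fin.
- exact: measurable_funeM.
move=> x _.
(* For fixed [x] the truncation [B * w n < v x] bounds the level by [v x / B], and one factor [w n]
   cancels; what remains is the sum of [dyadic_sum_le] with exponent [p - 1]. *)
have termE n : (((2 * w n) `^ p * (A / w n))%:E * (v x * \1_(F n) x)%:E =
    (2 `^ p * A * v x)%:E * ((2 ^+ n * a) `^ (p - 1) * (2 ^+ n * a < v x / B)%R%:R)%:E)%E.
  rewrite -!EFinM; congr EFin.
  have -> : \1_(F n) x = (2 ^+ n * a < v x / B)%R%:R :> R.
    rewrite indicE; congr (nat_of_bool _)%:R; rewrite ltr_pdivlMr// mulrC.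
    by apply/idP/idP; rewrite inE.
  rewrite powRM ?(ltW (w0 n))// -(@mulr_powRB1 _ (w n) p) ?(ltW (w0 n))// -/(w n).
  by field; rewrite gt_eqF.
under eq_eseriesr do rewrite termE.
rewrite nneseriesZl; last by move=> n _; rewrite lee_fin mulr_ge0 ?powR_ge0.
have V0 : 0 <= v x / B by rewrite divr_ge0// ltW.
apply: (@le_trans _ _ ((2 `^ p * A * v x)%:E *
    (2 `^ (p - 1) / (2 `^ (p - 1) - 1) * (v x / B) `^ (p - 1))%:E)%E).
  by rewrite lee_wpmul2l ?dyadic_sum_le// lee_fin !mulr_ge0 ?powR_ge0// ltW.
rewrite -!EFinM lee_fin powRM ?invr_ge0 ?(ltW B_gt0)//.
rewrite -(@mulr_powRB1 _ (v x) p)// /strong_constant.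
by rewrite le_eqVlt; apply/orP; left; apply/eqP; ring.
Qed.

Lemma weak_to_strong :
  (\int[mu]_x (u x `^ p) <= strong_constant%:E * \int[mu]_x (v x `^ p)%:E)%E.
Proof.
pose D n := [set x | u x = 0%E \/ ((n.+1%:R^-1)%:E < u x)%E].
have mD n : measurable (D n).
  rewrite /D (_ : mkset _ = (~` [set x | (0 < u x)%E]) `|` [set x | ((n.+1%:R^-1)%:E < u x)%E]).
    by apply: measurableU => //; exact: measurableC.
  apply/seteqP; split => x /= -[h|h]; [left|by right|left|by right].
    by rewrite h ltxx.
  by apply/eqP; rewrite eq_le u_ge0 andbT leNgt; apply/negP.
have UD : \bigcup_n D n = setT.
  apply/seteqP; split => // x _.
  have [/eqP u0|u0] := boolP (u x == 0%E); first by exists 0%N => //; left.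
  have {}u0 : (0 < u x)%E by rewrite lt0e u0 u_ge0.
  case E : (u x) u0 => [y| |//] y0; last first.
    by exists 0%N => //; right; rewrite E ltry.
  rewrite lte_fin in y0.
  have [n _ /(_ n (leqnn n)) /= hn] := near_infty_natSinv_lt (PosNum y0).
  by exists n => //; right; rewrite E lte_fin.
have nd : {homo D : n m / (n <= m)%N >-> (n <= m)%O}.
  move=> n m nm; rewrite subsetEset => x [h|h]; [by left|right].
  by rewrite (le_lt_trans _ h)// lee_fin lef_pV2 ?posrE// ler_nat.
have mup : measurable_fun setT (fun x => u x `^ p)%E.
  exact: (measurableT_comp (measurable_poweR p) mu_).
rewrite -[X in (integral _ X _ <= _)%E]UD.
have cv := @ge0_nondecreasing_set_cvg_integral _ _ _ D (fun x => u x `^ p)%E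
  mu nd mD (fun n => measurable_funTS mup)
  (fun n y _ => poweR_ge0 (u y) p).
rewrite -(cvg_lim _ cv)//; apply: lime_le; first by apply/cvg_ex; eexists; exact: cv.
by apply: nearW => n; apply: weak_to_strong_on; rewrite invr_gt0.
Qed.

End weak_to_strong.

(** * Null sets and Lebesgue points *)

(** As [P] may be nonmeasurable, its nullity is witnessed by the intersection of measurable covers
    of measure at most 1/(n + 1). *)
Lemma negligible_small {R : realType} {d : measure_display} {T : measurableType d}
    (mu : {measure set T -> \bar R}) (P : set T) :
  (forall e : R, 0 < e -> exists S, [/\ measurable S, P `<=` S & (mu S <= e%:E)%E]) ->
  mu.-negligible P.
Proof.
move=> h; have /choice[S SP] : forall n : nat, exists S,
    [/\ measurable S, P `<=` S & (mu S <= (n.+1%:R^-1)%:E)%E].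
  by move=> n; apply: h; rewrite invr_gt0.
exists (\bigcap_n S n); split.
- by apply: bigcapT_measurable => n; have [] := SP n.
- apply/eqP; rewrite eq_le measure_ge0 andbT; apply/lee_addgt0Pr => e e0.
  rewrite add0e.
  have [n _ /(_ n (leqnn n)) /= hn] := near_infty_natSinv_lt (PosNum e0).
  have [mS _ muS] := SP n.
  rewrite (@le_trans _ _ (mu (S n)))//; last by rewrite (le_trans muS)// lee_fin ltW.
  rewrite le_measure ?inE//; first by apply: bigcapT_measurable => k; have [] := SP k.
  exact: bigcap_inf.
- by move=> x Px n _; have [_ PS _] := SP n; exact: PS.
Qed.

(** Division by the radius stands for division by the measure of the ball, the two being comparable
    in these spaces. *)
Definition lebesgue_point {R : realType} {d : measure_display} {T : measurableType d}
    (delta : T -> T -> R) (mu : {measure set T -> \bar R}) (f : T -> R) (x : T) : Prop :=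
  forall e : R, 0 < e -> exists2 rho : R, 0 < rho &
    forall r, 0 < r -> r <= rho ->
      (\int[mu]_(y in dball delta x r) (`|f y - f x|)%:E <= (e * r)%:E)%E.

Section differentiation.
Context {R : realType} {d : measure_display} {T : measurableType d}.
Context {delta : T -> T -> R} {mu : {measure set T -> \bar R}}.
Context {tau c1 c2 : R}.
Hypothesis XN : space_N delta mu tau c1 c2.
Context {z : nat -> T} {r : nat -> R}.
Hypothesis r_gt0 : forall n, 0 < r n.
Hypothesis cover : forall x rho, 0 < rho ->
    exists2 n, dball delta x rho `<=` dball delta (z n) (r n) & r n <= 4 * tau * rho.
Local Notation ball := (dball delta).
Local Notation M := (ball_maximal delta mu z r).
Let mball := measurable_dball XN.
Hint Resolve mball : core.
Let kappa := tau * (1 + 2 * tau).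

Let kappa_gt0 : 0 < kappa.
Proof. by have t0 := tau_gt0 XN; rewrite /kappa mulr_gt0// addr_gt0// mulr_gt0. Qed.

(* Splitting |f| at height lam / (2 c2) costs at most lam / 2 in the maximal function. *)
Lemma ball_maximal_weak_split (f : T -> R) (lam : R) : measurable_fun setT f -> 0 < lam ->
  (mu [set x | (lam%:E < M (fun y => (`|f y|)%:E) x)%E] <=
   (2 * c2 * kappa / lam)%:E * \int[mu]_x (`|f x| * \1_[set x | (2 * c2)^-1 * lam < `|f x|] x)%:E)%E.
Proof.
move=> mf lam0; have c0 := c2_gt0 XN.
have mnf : measurable_fun setT (fun y => `|f y|) by exact: measurableT_comp.
set F := [set x | (2 * c2)^-1 * lam < `|f x|].
have mF : measurable F.
  rewrite /F (_ : mkset _ = [set: T] `&` (fun y => `|f y|) @^-1` `](2 * c2)^-1 * lam, +oo[).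
    exact: mnf.
  by rewrite setTI; apply/seteqP; split => x /=; rewrite in_itv/= andbT.
pose g1 x := (`|f x| * \1_F x)%:E.
have mg1 : measurable_fun setT g1.
  by apply/measurable_EFinP; apply: measurable_funM => //; exact: (measurable_indic mF).
have g10 x : (0 <= g1 x)%E by rewrite lee_fin mulr_ge0.
have t0 : 0 <= (2 * c2)^-1 * lam by rewrite mulr_ge0 ?invr_ge0 ?mulr_ge0// ltW.
have gg1 x : ((`|f x|)%:E <= g1 x + ((2 * c2)^-1 * lam)%:E)%E.
  rewrite /g1 -EFinD lee_fin indicE; have [Fx|Fx] := pselect (F x).
    by rewrite mem_set// mulr1 lerDl.
  by rewrite memNset// mulr0 add0r leNgt; apply/negP.
have l20 : 0 < lam / 2 by rewrite divr_gt0.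
have := ball_maximal_weak XN r_gt0 mg1 g10 _ l20.
rewrite -/kappa (_ : c2 * kappa / (lam / 2) = 2 * c2 * kappa / lam); last first.
  by field; rewrite gt_eqF.
move=> /(_ z) W; apply: (@le_trans _ _ _ _ _ _ W); apply: le_measure; rewrite ?inE.
- by apply: (measurable_ball_maximal_gt XN).
- by apply: (measurable_ball_maximal_gt XN).
- move=> x /= hx.
  have mnfE : measurable_fun setT (fun y => (`|f y|)%:E) by exact/measurable_EFinP.
  have nf0 y : (0 <= (`|f y|)%:E)%E by rewrite lee_fin.
  have hh := @ball_maximal_le_add _ _ _ _ _ _ _ _ XN z _ r_gt0 _ mnfE nf0 g1 _ x t0 mg1 g10 gg1.
  have := lt_le_trans hx hh.
  rewrite (_ : c2 * _ = lam / 2); last by field; rewrite gt_eqF.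
  rewrite -lteBlDr// -EFinB; apply: le_lt_trans.
  by rewrite lee_fin; lra.
Qed.

(** [ball_maximal_weak_split] is exactly the truncated weak estimate that [weak_to_strong] takes as
    hypothesis. *)
Lemma ball_maximal_strong (p : R) : 1 < p -> exists2 C : R, 0 <= C &
  forall f : T -> R, measurable_fun setT f ->
  (\int[mu]_x (M (fun y => (`|f y|)%:E) x `^ p) <= C%:E * \int[mu]_x (`|f x| `^ p)%:E)%E.
Proof.
move=> p1; have c0 := c2_gt0 XN.
have A0 : 0 < 2 * c2 * kappa by apply: mulr_gt0 => //; exact: mulr_gt0.
have B0 : 0 < (2 * c2)^-1 by rewrite invr_gt0 mulr_gt0.
exists (@strong_constant R (2 * c2 * kappa) (2 * c2)^-1 p).
  exact: strong_constant_ge0.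
move=> f mf.
have mnf : measurable_fun setT (fun y => `|f y|) by exact: measurableT_comp.
have nf0 y : (0 <= (`|f y|)%:E)%E by rewrite lee_fin.
apply: (@weak_to_strong R d T mu (M (fun y => (`|f y|)%:E)) (fun x => `|f x|)) => //.
- exact: (measurable_ball_maximal XN).
- by move=> x; exact: (ball_maximal_ge0 XN r_gt0 nf0 cover).
- by move=> lam lam0; exact: ball_maximal_weak_split.
Qed.

Hypothesis dense : forall f : T -> R, mu.-integrable setT (EFin \o f) ->
     forall eps : R, 0 < eps ->
     exists g : T -> R, [/\ delta_continuous delta g,
       mu.-integrable setT (EFin \o g) &
       (\int[mu]_x `|(f x - g x)%:E| < eps%:E)%E].

(** Approximate [f] in L^1 by a continuous [h]. Outside a set of small measure, the mean of |f - h|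
    near [x] is controlled by its maximal function and |f(x) - h(x)| by Chebyshev's inequality;
    continuity controls the oscillation of [h]. *)
Lemma lebesgue_point_ae (f : T -> R) : mu.-integrable setT (EFin \o f) ->
  {ae mu, forall x, lebesgue_point delta mu f x}.
Proof.
move=> intf; have c0 := c2_gt0 XN; have t0 := tau_gt0 XN.
have mf : measurable_fun setT f by apply/measurable_EFinP; case/integrableP: intf.
suff h (n : nat) : {ae mu, forall x, exists2 rho : R, 0 < rho &
    forall r, 0 < r -> r <= rho ->
      (\int[mu]_(y in ball x r) (`|f y - f x|)%:E <= (n.+1%:R^-1 * r)%:E)%E}.
  apply: filterS (ae_foralln h) => x hx e e0.
  have [n _ /(_ n (leqnn n)) /= hn] := near_infty_natSinv_lt (PosNum e0).
  have [rho rho0 hrho] := hx n; exists rho => // s s0 srho.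
  by rewrite (le_trans (hrho s s0 srho))// lee_fin ler_pM2r// ltW.
have : 0 < n.+1%:R^-1 :> R by rewrite invr_gt0.
move: (n.+1%:R^-1) => e e0.
apply: negligible_small => eta eta0.
(* [C / e] times the L^1 distance of [f] and [h] bounds the measure of the exceptional set: the
   first term serves the weak estimate for [S1], the second the Chebyshev bound for [S2]. *)
pose C := 12 * tau * c2 * kappa + 3 * c2.
have C0 : 0 < C.
  by apply: addr_gt0; [apply: mulr_gt0 => //; rewrite !mulr_gt0|exact: mulr_gt0].
have [h [hcont inth fh]] := dense f intf (eta * e / C) (divr_gt0 (mulr_gt0 eta0 e0) C0).
have mh : measurable_fun setT h by apply/measurable_EFinP; case/integrableP: inth.
have mfh : measurable_fun setT (fun y => f y - h y) by exact: measurable_funB.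
have mnfh : measurable_fun setT (fun y => `|f y - h y|) by exact: measurableT_comp.
pose g y := (`|f y - h y|)%:E.
have mg : measurable_fun setT g by apply/measurable_EFinP.
have g0 y : (0 <= g y)%E by rewrite lee_fin.
(* With these thresholds, on a ball of radius [s] the maximal function accounts for [e * s / 3] and
   the other two terms together for [2 * e * s / 3]. *)
pose S1 := [set x | ((e / (12 * tau))%:E < M g x)%E].
pose S2 := [set x | ((e / (3 * c2))%:E <= `|(f x - h x)%:E|)%E].
have mS1 : measurable S1 by exact: (measurable_ball_maximal_gt XN).
have mS2 : measurable S2.
  rewrite -[S2]setTI; exact: (emeasurable_fun_c_infty measurableT mg).
have e1 : 0 < e / (12 * tau) by rewrite divr_gt0// mulr_gt0.
have e2 : 0 < e / (3 * c2) by rewrite divr_gt0// mulr_gt0.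
exists (S1 `|` S2); split; first exact: measurableU.
- move=> x; apply: contra_notP => /not_orP[/= /negP + /negP].
  rewrite -leNgt -ltNge lte_fin => xS1 xS2.
  have [rho rho0 hrho] := hcont x _ e2.
  exists rho => // s s0 srho.
  apply: (@le_trans _ _ (\int[mu]_(y in ball x s) (g y + (2 * e / (3 * c2))%:E))%E).
    apply: ge0_le_integral => //.
    + apply/measurable_EFinP/measurable_funTS; apply: measurableT_comp => //.
      exact: measurable_funB.
    + by apply: measurable_funTS; exact: emeasurable_funD.
    + move=> y xy; rewrite -EFinD lee_fin.
      have hy : `|h y - h x| < e / (3 * c2) by apply: hrho; exact: lt_le_trans srho.
      have -> : 2 * e / (3 * c2) = e / (3 * c2) + e / (3 * c2) by ring.
      have -> : f y - f x = (f y - h y) + ((h y - h x) + (h x - f x)) by ring.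
      rewrite (le_trans (ler_normD _ _))// lerD2l (le_trans (ler_normD _ _))//.
      by rewrite lerD ?(ltW hy)// distrC ltW.
  rewrite ge0_integralD//; last 2 first.
  + exact: measurable_funTS.
  + by move=> y _; rewrite lee_fin divr_ge0 ?mulr_ge0// ltW.
  rewrite integral_cst//.
  apply: (@le_trans _ _ ((4 * tau * s)%:E * (e / (12 * tau))%:E +
      (2 * e / (3 * c2))%:E * (c2 * s)%:E)%E); last first.
    rewrite -!EFinM -EFinD lee_fin le_eqVlt; apply/orP; left; apply/eqP.
    by field; rewrite !gt_eqF.
  apply: leeD.
    rewrite (le_trans (integral_dball_le_maximal XN r_gt0 mg g0 cover x s s0))//.
    by rewrite lee_wpmul2l// lee_fin !mulr_ge0// ltW.
  rewrite lee_wpmul2l ?(measure_dball_le XN)// lee_fin divr_ge0 ?mulr_ge0// ltW//.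
- rewrite (le_trans (measureU2 _ _ _))//.
  have fhE : (\int[mu]_x g x = \int[mu]_x `|(f x - h x)%:E|)%E by [].
  have h1 := @ball_maximal_weak _ _ _ _ _ _ _ _ XN z _ r_gt0 _ mg g0 _ e1.
  have mfhE : measurable_fun setT (EFin \o (fun y => f y - h y)) by exact/measurable_EFinP.
  have h2 := le_integral_abse mu measurableT mfhE e2.
  rewrite setTI in h2; rewrite -/S1 -/kappa fhE in h1.
  rewrite muleC -lee_pdivlMr// in h2.
  move: h1 h2 fh => /=; set I := (\int[mu]_x _)%E => h1 h2 fh.
  apply: (@le_trans _ _ ((C / e)%:E * I)%E).
    apply: le_trans (leeD h1 h2) _.
    rewrite [X in (_ + X)%E]muleC -ge0_muleDl ?lee_fin//.
    + rewrite -EFinD lee_wpmul2r ?integral_ge0// lee_fin.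
      rewrite /C le_eqVlt; apply/orP; left; apply/eqP.
      by field; rewrite !gt_eqF.
    + by apply: divr_ge0 (ltW e1); apply: mulr_ge0; exact: ltW.
    + by rewrite invr_ge0 ltW.
  apply: (@le_trans _ _ ((C / e)%:E * (eta * e / C)%:E)%E).
    by rewrite lee_wpmul2l ?(ltW fh)// lee_fin divr_ge0// ltW.
  rewrite -EFinM lee_fin le_eqVlt; apply/orP; left; apply/eqP.
  by field; rewrite !gt_eqF.
Qed.

(** Being a Lebesgue point is local: balls are open, so near [x] the function agrees with its
    truncation to a ball around [x0] that contains [x]. *)
Lemma lebesgue_point_locally_ae (f : T -> R) x0 :
  (forall n : nat, mu.-integrable setT (EFin \o (fun y => f y * \1_(ball x0 n%:R) y))) ->
  {ae mu, forall x, lebesgue_point delta mu f x}.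
Proof.
move=> intf; have := ae_foralln (fun n => lebesgue_point_ae _ (intf n)).
apply: filterS => x hx e e0.
have [n _ xn] : (\bigcup_n ball x0 n%:R) x by rewrite bigcup_dball.
have [rho rho0 hrho] := hx n e e0.
have [s s0 sB] : exists2 s, 0 < s & ball x s `<=` ball x0 n%:R.
  by case: XN => -[_ bo _] _; exact: bo.
exists (Num.min rho s); first by rewrite lt_min rho0.
move=> t t0; rewrite le_min => /andP[trho ts].
rewrite (le_trans _ (hrho t t0 trho))// le_eqVlt; apply/orP; left; apply/eqP.
apply: eq_integral => y; rewrite inE => xy.
rewrite !indicE !mem_set ?mulr1//.
exact/sB/(dball_mono _ _ _ ts).
Qed.

End differentiation.

(** * Pointwise growth of functions of finite L^p norm *)

Section Lnorm_bounds.
Context {R : realType} {d : measure_display} {T : measurableType d}.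
Context {mu : {measure set T -> \bar R}}.
Hypothesis muT : (0 < mu setT)%E.

Lemma Lnorm_infty_ae (f : T -> R) : (Lnorm mu +oo%E (EFin \o f) < +oo)%E ->
  {ae mu, forall x, `|f x| <= fine (Lnorm mu +oo%E (EFin \o f))}.
Proof.
move=> Noo; have Nfin : Lnorm mu +oo%E (EFin \o f) \is a fin_num.
  by rewrite ge0_fin_numE ?Lnorm_ge0.
have NE : Lnorm mu +oo%E (EFin \o f) = ess_sup mu (abse \o (EFin \o f)).
  by rewrite unlock/= muT.
apply: filterS (ess_sup_ge mu (abse \o (EFin \o f))) => x /=.
by rewrite -NE -[X in (_ <= X)%E]fineK// lee_fin.
Qed.

(** One form of bound covers all exponents: |f| <= 1 + |f|^p for finite [p], and the essential
    supremum with [h = 0] for [p = +oo]. *)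
Lemma Lnorm_growth (p : \bar R) (f : T -> R) : (1 <= p)%E ->
  measurable_fun setT f -> (Lnorm mu p (EFin \o f) < +oo)%E ->
  exists C, exists h : T -> R, [/\ 0 <= C, measurable_fun setT h,
    forall x, 0 <= h x, (\int[mu]_x (h x)%:E < +oo)%E &
    {ae mu, forall x, `|f x| <= C + h x}].
Proof.
case: p => [p p1 mf Noo|_ mf Noo|//].
  rewrite lee_fin in p1; have p0 : p != 0 by rewrite gt_eqF// (lt_le_trans _ p1).
  exists 1, (fun x => `|f x| `^ p); split => //.
  - apply: (measurableT_comp (measurable_powR p)).
    exact: measurableT_comp.
  - by rewrite -(poweR_Lnorm mu (EFin \o f) p0); exact: poweR_lty.
  - apply: nearW => x; have [f1|f1] := leP `|f x| 1.
      by rewrite (le_trans f1)// lerDl powR_ge0.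
    by rewrite (le_trans (le1r_powR (ltW f1) p1))// lerDr.
exists (fine (Lnorm mu +oo%E (EFin \o f))), (fun=> 0); split => //.
- by rewrite fine_ge0// Lnorm_ge0.
- by rewrite integral0.
- by apply: filterS (Lnorm_infty_ae f Noo) => x; rewrite addr0.
Qed.

End Lnorm_bounds.

(** * Concentration and almost everywhere convergence *)

Section approximate_identity.
Context {R : realType} {d : measure_display} {T : measurableType d}.
Context {delta : T -> T -> R} {mu : {measure set T -> \bar R}}.
Context {tau c1 c2 s : R} {K : R -> T -> T -> R} {gamma H R0 : R}.
Hypothesis XN : space_N delta mu tau c1 c2.
Hypothesis s_gt0 : 0 < s.
Hypothesis KM : forall a, 0 < a < 1 -> sym_markov_kernel mu (K a).
Hypothesis H_ge1 : 1 <= H.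
Hypothesis gamma_gt0 : 0 < gamma.
Hypothesis gamma_le : gamma <= (c1 / (2 * c2)) ^+ 2.
Hypothesis KH : forall a, 0 < a < 1 -> in_Ha delta gamma H (K a).
Hypothesis R0_gt0 : 0 < R0.
Hypothesis KS : forall a, 0 < a < 1 -> in_S delta s a R0 (K a).
Local Notation ball := (dball delta).
Let mball := measurable_dball XN.
Hint Resolve mball : core.

Let H_gt0 : 0 < H. Proof. exact: lt_le_trans H_ge1. Qed.

Let measurable_far x (lam : R) : measurable [set y | lam <= delta x y].
Proof.
rewrite (_ : mkset _ = ~` ball x lam); first exact: measurableC.
by apply/seteqP; split => y /=; rewrite /dball/= leNgt => /negP.
Qed.

(** Finitely many uses of [in_S_step] bring the threshold [R0] below [lam]; their number [n], hence
    [C = H ^+ n], depends neither on the kernel nor on the points. *)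
Lemma kernel_far_bound (lam : R) : 0 < lam -> exists2 C : R, 0 <= C &
  forall a x y, 0 < a < 1 -> lam <= delta x y ->
    K a x y <= C * a * (delta x y) `^ (- (1 + s)).
Proof.
move=> lam0; have q0 := ratio_gt0 XN; have q1 := ratio_lt1 XN.
have iter n a : 0 < a < 1 ->
    in_S delta s (H ^+ n * a) ((c1 / (2 * c2)) ^+ n * R0) (K a).
  move=> a01; elim: n => [|n ih]; first by rewrite !expr0 !mul1r; exact: KS.
  rewrite !exprS -(mulrA H) -(mulrA (c1 / _)); apply: (in_S_step XN _ gamma H _ _ _ H_ge1 gamma_gt0 gamma_le (KH a a01) s_gt0 _ _ ih).
  - by rewrite mulr_ge0 ?exprn_ge0 ?(ltW H_gt0)//; case/andP: a01 => /ltW.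
  - by rewrite mulr_gt0// exprn_gt0.
have [n hn] := expr_lt_eps _ _ q0 q1 (divr_gt0 lam0 R0_gt0).
exists (H ^+ n); first by rewrite exprn_ge0// ltW.
move=> a x y a01 lxy; apply: iter => //.
by rewrite (lt_le_trans _ lxy)// -ltr_pdivlMr.
Qed.

Lemma kernel_tail (lam : R) : 0 < lam -> exists2 W : R, 0 <= W &
  forall a x, 0 < a < 1 ->
    (\int[mu]_(y in [set y | (lam <= delta x y)%R]) (K a x y)%:E <= (W * a)%:E)%E.
Proof.
move=> lam0; have [C C0 hC] := kernel_far_bound lam lam0.
have c0 := c2_gt0 XN.
exists (C * (2 * c2 * lam `^ (- s) / (1 - 2 `^ (- s)))).
  rewrite mulr_ge0// divr_ge0 ?mulr_ge0 ?powR_ge0 ?(ltW c0)// subr_ge0 powRN.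
  by rewrite invf_le1 ?powR_gt0// ltW// powR2_gt1.
move=> a x a01; have [k0 _ _ _] := KM a a01; have mk := measurable_kernel_section mu _ x (KM a a01).
have Ca0 : 0 <= C * a by rewrite mulr_ge0//; case/andP: a01 => /ltW.
rewrite (le_trans (tail_integral_le XN _ x _ _ _ (k0 x) mk Ca0 s_gt0 lam0 _))//.
  by move=> y; exact: hC.
by rewrite lee_fin le_eqVlt; apply/orP; left; apply/eqP; ring.
Qed.

Lemma concentration (lam eps : R) : 0 < lam -> 0 < eps ->
  exists2 a0 : R, 0 < a0 & forall a x, 0 < a -> a < a0 -> a < 1 ->
    (\int[mu]_(y in [set y | (lam <= delta x y)%R]) (K a x y)%:E <= eps%:E)%E.
Proof.
move=> lam0 eps0; have [W W0 hW] := kernel_tail lam lam0.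
have W10 : 0 < W + 1 by rewrite ltr_wpDl.
(* [W + 1] avoids a division by zero when [W = 0]. *)
exists (eps / (W + 1)); first exact: divr_gt0.
move=> a x a0; rewrite ltr_pdivlMr// => aW a1.
rewrite (le_trans (hW a x _)) ?a0// lee_fin; lra.
Qed.

Section pointwise.
Context {f h : T -> R} {C : R}.
Hypothesis mf : measurable_fun setT f.
Hypothesis C_ge0 : 0 <= C.
Hypothesis mh : measurable_fun setT h.
Hypothesis h_ge0 : forall x, 0 <= h x.
Hypothesis int_h : (\int[mu]_x (h x)%:E < +oo)%E.
Hypothesis f_le : {ae mu, forall x, `|f x| <= C + h x}.

(** Almost everywhere |f(y) - f(x)| is at most C + |f(x)| + h(y). The constant part is integrated
    against the tail mass of the kernel; the integrable part [h] against the uniform bound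
    [C' * a * L] of the kernel far from [x]. *)
Lemma kernel_tail_growth x (lam : R) : 0 < lam -> exists2 W : R, 0 <= W &
  forall a, 0 < a < 1 ->
    (\int[mu]_(y in [set y | (lam <= delta x y)%R]) (K a x y * `|f y - f x|)%:E
      <= (W * a)%:E)%E.
Proof.
move=> lam0; have [W W0 hW] := kernel_tail lam lam0.
have [C' C'0 hC'] := kernel_far_bound lam lam0.
have Ih : (\int[mu]_y (h y)%:E)%E \is a fin_num.
  by rewrite ge0_fin_numE ?integral_ge0// => y _; rewrite lee_fin.
pose I := fine (\int[mu]_y (h y)%:E)%E.
have IE : (\int[mu]_y (h y)%:E)%E = I%:E by rewrite fineK.
have I0 : 0 <= I by rewrite fine_ge0// integral_ge0// => y _; rewrite lee_fin.
pose L := lam `^ (- (1 + s)).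
have L0 : 0 <= L by exact: powR_ge0.
have b0 : 0 <= C + `|f x| by rewrite addr_ge0.
exists ((C + `|f x|) * W + C' * L * I).
  by apply: addr_ge0; [exact: mulr_ge0|apply: mulr_ge0 => //; exact: mulr_ge0].
move=> a a01; have [k0 _ _ _] := KM a a01.
have mk := measurable_kernel_section mu _ x (KM a a01).
have a0 : 0 <= a by case/andP: a01 => /ltW.
set D := mkset _; have mD : measurable D by exact: measurable_far.
have mkE S : measurable_fun S (fun y => (K a x y)%:E).
  by apply: measurable_funTS; exact/measurable_EFinP.
have mhE S : measurable_fun S (fun y => (h y)%:E).
  by apply: measurable_funTS; exact/measurable_EFinP.
have mu1 : measurable_fun setT (fun y => (K a x y * `|f y - f x|)%:E).
  apply/measurable_EFinP; apply: measurable_funM => //; apply: measurableT_comp => //.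
  exact: measurable_funB.
have k0E y : (0 <= (K a x y)%:E)%E by rewrite lee_fin.
have h0E y : (0 <= (h y)%:E)%E by rewrite lee_fin.
apply: (@le_trans _ _ (\int[mu]_(y in D) ((C + `|f x|)%:E * (K a x y)%:E +
    (C' * a * L)%:E * (h y)%:E))%E).
  apply: ae_ge0_le_integral => //.
  - by move=> y _; rewrite lee_fin mulr_ge0.
  - exact: measurable_funTS.
  - by move=> y _; rewrite adde_ge0// mule_ge0// lee_fin// !mulr_ge0.
  - by apply: emeasurable_funD; exact: measurable_funeM.
  - apply: filterS f_le => y fy Dy; rewrite -!EFinM -EFinD lee_fin.
    apply: (@le_trans _ _ (K a x y * ((C + `|f x|) + h y))).
      rewrite ler_wpM2l// (le_trans (ler_normB _ _))//.
      by rewrite addrAC lerD2r.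
    rewrite mulrDr lerD//; first by rewrite mulrC.
    rewrite ler_wpM2r// (le_trans (hC' a x y a01 Dy))//.
    rewrite ler_wpM2l ?mulr_ge0//; apply: powR_opp_le => //.
    by rewrite addr_ge0// ltW.
rewrite ge0_integralD//; last 4 first.
- by move=> y _; rewrite mule_ge0// lee_fin.
- exact: measurable_funeM.
- by move=> y _; rewrite mule_ge0// lee_fin !mulr_ge0.
- exact: measurable_funeM.
rewrite !ge0_integralZl_EFin//; last by rewrite !mulr_ge0.
apply: (@le_trans _ _ ((C + `|f x|)%:E * (W * a)%:E + (C' * a * L)%:E * I%:E)%E).
  apply: leeD.
    by rewrite lee_wpmul2l ?hW// lee_fin.
  rewrite lee_wpmul2l ?lee_fin ?mulr_ge0// -IE ge0_subset_integral//.
rewrite -!EFinM -EFinD lee_fin le_eqVlt; apply/orP; left; apply/eqP; ring.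
Qed.

Lemma kernel_oscillation_small x (eps : R) : lebesgue_point delta mu f x -> 0 < eps ->
  exists2 a0 : R, 0 < a0 & forall a, 0 < a -> a < a0 -> a < 1 ->
    (\int[mu]_y (K a x y * `|f y - f x|)%:E <= eps%:E)%E.
Proof.
move=> fx eps0; have c0 := c1_gt0 XN.
(* Chosen so that [kernel_dball_le], with its factor [2 * H / c1], bounds the part near [x] by
   [eps / 2]. *)
have e0 : 0 < eps * c1 / (4 * H) by rewrite divr_gt0// mulr_gt0.
have [rho rho0 hrho] := fx _ e0.
have [W W0 hW] := kernel_tail_growth x rho rho0.
have W10 : 0 < W + 1 by rewrite ltr_wpDl.
exists (eps / 2 / (W + 1)); first by rewrite !divr_gt0.
move=> a a0; rewrite ltr_pdivlMr// => aW a1.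
have a01 : 0 < a < 1 by rewrite a0.
have [k0 _ _ k1] := KM a a01.
have mk := measurable_kernel_section mu _ x (KM a a01).
have mg : measurable_fun setT (fun y => `|f y - f x|).
  by apply: measurableT_comp => //; exact: measurable_funB.
have mkg : measurable_fun setT (fun y => (K a x y * `|f y - f x|)%:E).
  by apply/measurable_EFinP; exact: measurable_funM.
have kg0 y : (0 <= (K a x y * `|f y - f x|)%:E)%E by rewrite lee_fin mulr_ge0.
have UE : setT = ball x rho `|` [set y | rho <= delta x y].
  by apply/seteqP; split => // y _; rewrite /dball/=; case: ltP; [left|right].
rewrite UE ge0_integral_setU//; last 2 first.
- exact: measurable_funTS.
- by apply/disj_setPS => y [/=]; rewrite /dball/= ltNge => /negP.
apply: (@le_trans _ _ ((eps / 2)%:E + (eps / 2)%:E)%E); last first.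
  by rewrite -EFinD lee_fin -splitr.
apply: leeD; last by rewrite (le_trans (hW a a01))// lee_fin; lra.
have -> : eps / 2 = 2 * H / c1 * (eps * c1 / (4 * H)).
  by field; rewrite !gt_eqF.
apply: (kernel_dball_le XN (k0 x) mk _ H_ge1 gamma_gt0 gamma_le) => //.
- by rewrite k1.
- by move=> t t0 y y'; exact: KH.
- exact: ltW.
Qed.

(** As the kernels have mass one, the error at [x] is the integral of K(x, y)(f(y) - f(x)), which
    the oscillation estimate makes small. *)
Lemma kernel_op_cvg x : lebesgue_point delta mu f x ->
  kernel_op mu (K a) f x @[a --> 0^'+] --> (f x)%:E.
Proof.
move=> fx.
(* Convergence of extended reals to a real limit needs eventual finiteness as well as the error
   bound; the witness [D] gives both. *)
have near_op (eps : R) : 0 < eps -> \forall a \near 0^'+,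
    exists2 D : R, kernel_op mu (K a) f x = (D + f x)%:E & `|D| <= eps.
  move=> eps0; have [a0 a00 ha0] := kernel_oscillation_small x eps fx eps0.
  near=> a.
  have ap : 0 < a by near: a; exact: nbhs_right_gt.
  have aa0 : a < a0 by near: a; exact: nbhs_right_lt.
  have a1 : a < 1 by near: a; exact: nbhs_right_lt.
  have a01 : 0 < a < 1 by rewrite ap.
  have [k0 _ _ k1] := KM a a01.
  have mk := measurable_kernel_section mu _ x (KM a a01).
  have mg : measurable_fun setT (fun y => f y - f x) by exact: measurable_funB.
  have normE : (\int[mu]_y `|(K a x y * (f y - f x))%:E| =
      \int[mu]_y (K a x y * `|f y - f x|)%:E)%E.
    by apply: eq_integral => y _; rewrite /= normrM (ger0_norm (k0 x y)).
  have mkg : measurable_fun setT (EFin \o (fun y => K a x y * (f y - f x))).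
    by apply/measurable_EFinP; exact: measurable_funM.
  have int1 : mu.-integrable setT (EFin \o (fun y => K a x y * (f y - f x))).
    apply/integrableP; split => //; rewrite /= normE.
    by rewrite (le_lt_trans (ha0 a ap aa0 a1))// ltry.
  have intk : mu.-integrable setT (EFin \o K a x).
    apply/integrableP; split; first exact/measurable_EFinP.
    have -> : (\int[mu]_y `|(EFin \o K a x) y| = \int[mu]_y (K a x y)%:E)%E.
      by apply: eq_integral => y _; rewrite /= (ger0_norm (k0 x y)).
    by rewrite k1 ltry.
  have int2 : mu.-integrable setT (EFin \o (fun y => K a x y * f x)).
    by have := integrableZr measurableT (f x) intk.
  have fin1 := integrable_fin_num measurableT int1.
  exists (fine (\int[mu]_y (EFin \o (fun y => (K a x y * (f y - f x))%R)) y)%E).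
    rewrite EFinD fineK//.
    have <- : (\int[mu]_y (EFin \o (fun y => (K a x y * f x)%R)) y = (f x)%:E)%E.
      by rewrite -[RHS]mul1e -(k1 x) -integralZr.
    rewrite -integralD_EFin//; apply: eq_integral => y _ /=.
    by rewrite -EFinD -mulrDr subrK.
  rewrite -lee_fin -abse_EFin fineK// (le_trans (le_abse_integral _ _ _))//.
  by rewrite /= normE; exact: ha0.
apply/fine_cvgP; split.
  by apply: filterS (near_op 1 ltr01) => a [D -> _].
apply/cvgrPdist_le => eps eps0; apply: filterS (near_op eps eps0) => a [D /= -> D_le].
by rewrite /= opprD addrCA subrr addr0 normrN.
Unshelve. all: by end_near. Qed.

Lemma growth_locally_integrable x0 (n : nat) :
  mu.-integrable setT (EFin \o (fun y => f y * \1_(ball x0 n%:R) y)).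
Proof.
have mB := mball x0 n%:R.
have mind : measurable_fun setT (\1_(ball x0 n%:R) : T -> R) by exact: measurable_indic.
have mfB : measurable_fun setT (fun y => f y * \1_(ball x0 n%:R) y) by exact: measurable_funM.
apply/integrableP; split; first exact/measurable_EFinP.
have h0E y : (0 <= (h y)%:E)%E by rewrite lee_fin.
have mhE : measurable_fun setT (fun y => (h y)%:E) by exact/measurable_EFinP.
have mindE : measurable_fun setT (fun y => (\1_(ball x0 n%:R) y)%:E : \bar R) by exact/measurable_EFinP.
apply: (@le_lt_trans _ _ (\int[mu]_y (C%:E * (\1_(ball x0 n%:R) y)%:E + (h y)%:E))%E).
  apply: ae_ge0_le_integral => //.
  - by apply/measurable_EFinP; exact: measurableT_comp.
  - by move=> y _; rewrite adde_ge0// mule_ge0// lee_fin.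
  - by apply: emeasurable_funD => //; exact: measurable_funeM.
  - apply: filterS f_le => y fy _; rewrite /= -EFinM -EFinD lee_fin indicE.
    case: (y \in _) => /=; first by rewrite !mulr1.
    by rewrite !mulr0 normr0 add0r.
rewrite ge0_integralD//; last 2 first.
- by move=> y _; rewrite mule_ge0// lee_fin.
- exact: measurable_funeM.
rewrite lte_add_pinfty// ge0_integralZl_EFin//.
rewrite integral_indic// setIT lte_mul_pinfty ?lee_fin//.
(* The radius is enlarged to [n.+1] because [n] may be 0 and the measure bound needs a positive
   radius. *)
apply: (@le_lt_trans _ _ (c2 * n.+1%:R)%:E); last exact: ltry.
rewrite (le_trans _ (measure_dball_le XN x0 _ _))// le_measure ?inE//.
by apply: dball_mono; rewrite ler_nat.
Qed.

End pointwise.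
End approximate_identity.

(** * Weak type and L^p bounds for the maximal operator of the kernels *)

Section max_op_bounds.
Context {R : realType} {d : measure_display} {T : measurableType d}.
Context {delta : T -> T -> R} {mu : {measure set T -> \bar R}}.
Context {tau c1 c2 : R} {K : R -> T -> T -> R} {gamma H : R}.
Hypothesis XN : space_N delta mu tau c1 c2.
Context {z : nat -> T} {r : nat -> R}.
Hypothesis r_gt0 : forall n, 0 < r n.
Hypothesis cover : forall x rho, 0 < rho ->
    exists2 n, dball delta x rho `<=` dball delta (z n) (r n) & r n <= 4 * tau * rho.
Hypothesis KM : forall a, 0 < a < 1 -> sym_markov_kernel mu (K a).
Hypothesis H_ge1 : 1 <= H.
Hypothesis gamma_gt0 : 0 < gamma.
Hypothesis gamma_le : gamma <= (c1 / (2 * c2)) ^+ 2.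
Hypothesis KH : forall a, 0 < a < 1 -> in_Ha delta gamma H (K a).
Local Notation M := (ball_maximal delta mu z r).

Let A := 8 * H * tau / c1.

Let A_gt0 : 0 < A.
Proof.
have t0 := tau_gt0 XN; have c0 := c1_gt0 XN.
by rewrite divr_gt0// !mulr_gt0// (lt_le_trans _ H_ge1).
Qed.

(** The operator is a supremum over uncountably many kernels, so the estimate is stated for a
    measurable set containing its superlevel set: the superlevel set of the ball maximal function at
    height [lam / A]. *)
Lemma max_op_weak : exists2 C : R, 0 <= C & forall f : T -> R,
     mu.-integrable setT (EFin \o f) -> forall lam : R, 0 < lam ->
     exists2 S : set T, measurable S &
       [set x | (lam%:E < max_op mu K f x)%E] `<=` S /\
       (mu S <= (C / lam)%:E * \int[mu]_x `|(f x)%:E|)%E.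
Proof.
have t0 := tau_gt0 XN; have c0 := c2_gt0 XN.
exists (c2 * (tau * (1 + 2 * tau)) * A).
  by apply: mulr_ge0; [rewrite !mulr_ge0 ?addr_ge0 ?mulr_ge0//; exact: ltW|exact: ltW].
move=> f intf lam lam0.
have mf : measurable_fun setT f by apply/measurable_EFinP; case/integrableP: intf.
have mnfE : measurable_fun setT (fun y => (`|f y|)%:E).
  by apply/measurable_EFinP; exact: measurableT_comp.
have nf0 y : (0 <= (`|f y|)%:E)%E by rewrite lee_fin.
have l0 : 0 < A^-1 * lam by rewrite mulr_gt0 ?invr_gt0.
exists [set x | ((A^-1 * lam)%:E < M (fun y => (`|f y|)%:E) x)%E].
  exact: (measurable_ball_maximal_gt XN).
split.
  move=> x /= lx; rewrite EFinM lte_pdivrMl// (lt_le_trans lx)//.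
  exact: (max_op_le_ball_maximal XN r_gt0 cover KM H_ge1 gamma_gt0 gamma_le KH).
have := @ball_maximal_weak _ _ _ _ _ _ _ _ XN z _ r_gt0 _ mnfE nf0 _ l0.
rewrite (_ : _ / (A^-1 * lam) = c2 * (tau * (1 + 2 * tau)) * A / lam)//.
by field; rewrite !gt_eqF.
Qed.

(** For [p = +oo] the mass one of the kernels gives the constant 1, with the norm of [f] as
    majorant. For finite [p] the measurable majorant is [A] times the ball maximal function. *)
Lemma max_op_Lp (p : \bar R) : (1 < p)%E ->
     exists2 C : R, 0 <= C & forall f : T -> R, measurable_fun setT f ->
       (Lnorm mu p (EFin \o f) < +oo)%E ->
       exists g : T -> R, [/\ measurable_fun setT g,
         {ae mu, forall x, (max_op mu K f x <= (g x)%:E)%E} &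
         (Lnorm mu p (EFin \o g) <= C%:E * Lnorm mu p (EFin \o f))%E].
Proof.
have muT : (0 < mu setT)%E by rewrite (measure_space XN).
case: p => [p|_|//]; last first.
  exists 1 => // f mf Noo; set N := Lnorm _ _ _ in Noo *.
  have N0 : (0 <= N)%E by exact: Lnorm_ge0.
  have Nfin : N \is a fin_num by rewrite ge0_fin_numE.
  exists (cst (fine N)); split; first exact: measurable_cst.
    apply: nearW => x; apply: ge_ereal_sup => _ [a /= a01 <-].
    have {}a01 : 0 < a < 1 by move: a01; rewrite in_itv.
    have mk := measurable_kernel_section mu (K a) x (KM a a01).
    have [k0 _ _ k1] := KM a a01.
    have mkE : measurable_fun setT (fun y => (K a x y)%:E) by exact/measurable_EFinP.
    have mkf : measurable_fun setT (fun y => (K a x y * f y)%:E).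
      by apply/measurable_EFinP; exact: measurable_funM.
    rewrite /kernel_op (le_trans (le_abse_integral _ _ _))//.
    apply: (@le_trans _ _ (\int[mu]_y ((fine N)%:E * (K a x y)%:E))%E).
      apply: ae_ge0_le_integral => //.
      - exact: measurableT_comp.
      - by move=> y _; rewrite mule_ge0// lee_fin// fine_ge0.
      - exact: measurable_funeM.
      - apply: filterS (Lnorm_infty_ae muT f Noo) => y fy _.
        rewrite /= -EFinM lee_fin normrM (ger0_norm (k0 x y)) mulrC.
        by rewrite ler_wpM2r.
    rewrite ge0_integralZl_EFin ?fine_ge0//; last by move=> y _; rewrite lee_fin.
    by rewrite k1 mule1.
  rewrite mul1e unlock/= muT.
  rewrite (_ : abse \o _ = cst N); first by rewrite ess_sup_cst.
  by apply/funext => x /=; rewrite ger0_norm ?fine_ge0// fineK.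
rewrite lte_fin => p1; have p0 : 0 < p by exact: lt_trans p1.
have [C C0 hC] := ball_maximal_strong XN r_gt0 cover p p1.
have AC0 : 0 <= A `^ p * C by rewrite mulr_ge0// powR_ge0.
exists ((A `^ p * C) `^ p^-1); first exact: powR_ge0.
move=> f mf Noo.
have mnfE : measurable_fun setT (fun y => (`|f y|)%:E).
  by apply/measurable_EFinP; exact: measurableT_comp.
have nf0 y : (0 <= (`|f y|)%:E)%E by rewrite lee_fin.
pose u := M (fun y => (`|f y|)%:E).
have u0 x : (0 <= u x)%E by exact: (ball_maximal_ge0 XN r_gt0 nf0 cover).
have mu_ : measurable_fun setT u by exact: (measurable_ball_maximal XN).
have mup : measurable_fun setT (fun x => u x `^ p)%E.
  exact: (measurableT_comp (measurable_poweR p) mu_).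
have If : (\int[mu]_x (`|f x| `^ p)%:E < +oo)%E.
  have p_neq0 : p != 0 by rewrite gt_eqF.
  by rewrite -(poweR_Lnorm mu (EFin \o f) p_neq0); exact: poweR_lty.
have Iu : (\int[mu]_x (u x `^ p) < +oo)%E.
  by rewrite (le_lt_trans (hC f mf))// lte_mul_pinfty// lee_fin.
(* Integrability of the [p]-th power makes [u] finite almost everywhere, so [fine] alters it only on
   a null set. *)
have u_fin : {ae mu, forall x, u x \is a fin_num}.
  have intu : mu.-integrable setT (fun x => u x `^ p)%E.
    apply/integrableP; split => //.
    by under eq_integral do rewrite gee0_abs ?poweR_ge0//.
  apply: filterS (integrable_ae measurableT intu) => x /(_ I).
  rewrite !ge0_fin_numE ?poweR_ge0//; apply: lty_poweRy.
  by rewrite gt_eqF.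
have mg : measurable_fun setT (fun x => A * fine (u x)).
  apply: measurable_funM => //; apply: measurableT_comp => //.
exists (fun x => A * fine (u x)); split => //.
  apply: filterS u_fin => x ux; rewrite EFinM fineK//.
  exact: (max_op_le_ball_maximal XN r_gt0 cover KM H_ge1 gamma_gt0 gamma_le KH).
rewrite unlock/= -poweR_EFin -poweRM ?lee_fin//; last first.
  by apply: integral_ge0 => x _; rewrite lee_fin powR_ge0.
apply: gt0_ler_poweR; rewrite ?invr_ge0 ?(ltW p0)//.
- by rewrite in_itv/= leey andbT; apply: integral_ge0 => x _; rewrite lee_fin powR_ge0.
- rewrite in_itv/= leey andbT mule_ge0 ?lee_fin//.
  by apply: integral_ge0 => x _; rewrite lee_fin powR_ge0.
rewrite EFinM -muleA.
apply: (@le_trans _ _ ((A `^ p)%:E * \int[mu]_x (u x `^ p))%E); last first.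
  by rewrite lee_wpmul2l ?lee_fin ?powR_ge0// hC.
rewrite -ge0_integralZl_EFin ?powR_ge0//; last by move=> x _; exact: poweR_ge0.
apply: ge0_le_integral => //.
- apply/measurable_EFinP; apply: (measurableT_comp (measurable_powR p)).
  exact: measurableT_comp.
- exact: measurable_funeM.
move=> x _.
have fu0 : 0 <= fine (u x) by rewrite fine_ge0.
have Afu0 : 0 <= A * fine (u x) by apply: mulr_ge0 => //; exact: ltW.
rewrite ger0_norm// powRM//; last exact: ltW.
rewrite EFinM lee_wpmul2l ?lee_fin ?powR_ge0//.
(* Where [u x = +oo], [fine] returns 0 and the right-hand side is infinite. *)
case: (u x) (u0 x) => [y|h|h] //=.
by rewrite gt_eqF// leey.
Qed.

End max_op_bounds.

Theorem theorem4p5 (R : realType) (d : measure_display) (T : measurableType d)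
    (delta : T -> T -> R) (mu : {measure set T -> \bar R})
    (tau c1 c2 s : R) (K : R -> T -> T -> R) (gamma H R0 : R) :
  space_N delta mu tau c1 c2 ->
  (* continuous functions are dense in L^1(X, mu) *)
  (forall f : T -> R, mu.-integrable setT (EFin \o f) ->
     forall eps : R, 0 < eps ->
     exists g : T -> R, [/\ delta_continuous delta g,
       mu.-integrable setT (EFin \o g) &
       (\int[mu]_x `|(f x - g x)%:E| < eps%:E)%E]) ->
  0 < s ->
  (forall a, 0 < a < 1 -> sym_markov_kernel mu (K a)) ->
  (* (a) *)
  1 <= H -> 0 < gamma -> gamma <= (c1 / (2 * c2)) ^+ 2 ->
  (forall a, 0 < a < 1 -> in_Ha delta gamma H (K a)) ->
  (* (b) *)
  0 < R0 -> (forall a, 0 < a < 1 -> in_S delta s a R0 (K a)) ->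
  (* (i) concentration, uniformly in x *)
  (forall lam : R, 0 < lam -> forall eps : R, 0 < eps ->
     exists2 a0 : R, 0 < a0 & forall a x, 0 < a -> a < a0 -> a < 1 ->
       (\int[mu]_(y in [set y | (lam <= delta x y)%R]) (K a x y)%:E <= eps%:E)%E)
  /\
  (* (ii) weak type (1,1) of the maximal operator *)
  (exists2 C : R, 0 <= C & forall f : T -> R,
     mu.-integrable setT (EFin \o f) -> forall lam : R, 0 < lam ->
     exists2 A : set T, measurable A &
       [set x | (lam%:E < max_op mu K f x)%E] `<=` A /\
       (mu A <= (C / lam)%:E * \int[mu]_x `|(f x)%:E|)%E)
  /\
  (* (ii) L^p boundedness of the maximal operator, 1 < p <= oo *)
  (forall p : \bar R, (1 < p)%E ->
     exists2 C : R, 0 <= C & forall f : T -> R, measurable_fun setT f ->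
       (Lnorm mu p (EFin \o f) < +oo)%E ->
       exists g : T -> R, [/\ measurable_fun setT g,
         {ae mu, forall x, (max_op mu K f x <= (g x)%:E)%E} &
         (Lnorm mu p (EFin \o g) <= C%:E * Lnorm mu p (EFin \o f))%E])
  /\
  (* (iii) a.e. convergence for f in L^p, 1 <= p <= oo *)
  (forall p : \bar R, (1 <= p)%E ->
     forall f : T -> R, measurable_fun setT f ->
       (Lnorm mu p (EFin \o f) < +oo)%E ->
       {ae mu, forall x, kernel_op mu (K a) f x @[a --> 0^'+] --> (f x)%:E}).
Proof.
move=> XN dense s0 KM H1 g0 gq KH R00 KS.
have [z [r [r0 cover]]] := countable_ball_family XN.
split; first by move=> lam lam0 eps eps0; exact: (concentration XN s0 KM H1 g0 gq KH R00 KS).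
split; first exact: (max_op_weak XN r0 cover KM H1 g0 gq KH).
split; first exact: (max_op_Lp XN r0 cover KM H1 g0 gq KH).
move=> p p1 f mf Noo.
have muT : (0 < mu setT)%E by rewrite (measure_space XN).
(* The exponent enters only through this growth bound, from which the convergence follows for every
   [p] at once. *)
have [C [h [C0 mh h0 inth f_le]]] := Lnorm_growth muT p f p1 mf Noo.
have [x0 _] := exists_point XN.
have := lebesgue_point_locally_ae XN r0 cover dense f x0
  (growth_locally_integrable XN mf C0 mh h0 inth f_le x0).
apply: filterS => x.
exact: (kernel_op_cvg XN s0 KM H1 g0 gq KH R00 KS mf C0 mh h0 inth f_le).
Qed.
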